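(* Let $G$ be a finitely generated group. Then exactly one of the following holds: (1) $G$ has an infinite cyclic quotient and $\chi_F(G)$ consists of all positive integers; (2) $G$ has an infinite dihedral quotient but no infinite cyclic quotient, and $\mathrm{d}(\chi_F(G))=1/2$; (3) $G$ has no infinite cyclic quotient and no infinite dihedral quotient, and $\mathrm{d}(\chi_F(G))=0$.
   Context: $\mathbb{N}$ denotes the set of positive integers. For a group $G$, $\chi_F(G)$ denotes the set of indices of normal subgroups of finite index of $G$ (equivalently, the set of orders of finite quotients of $G$). For $X\subseteq\mathbb{N}$, the natural density of $X$ is $\mathrm{d}(X)=\lim_{n\to\infty}\frac{|X\cap\{1,\ldots,n\}|}{n}$, if that limit exists; a statement $\mathrm{d}(X)=c$ includes the assertion that the limit exists. A group $G$ ''has a quotient'' of a given type if some $G/N$ ($N$ normal in $G$) is isomorphic to a group of that type. The infinite dihedral group is $\mathbb{Z}\rtimes \mathrm{C}_2$ with $\mathrm{C}_2$ acting by inversion. *)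

(* Defs.v *)
From HB Require Import structures.
From mathcomp Require Import all_boot all_order all_algebra.
From mathcomp Require Import all_classical all_reals all_analysis.

Set Implicit Arguments.
Unset Strict Implicit.
Unset Printing Implicit Defensive.

Import Order.TTheory GRing.Theory Num.Theory.
Import numFieldNormedType.Exports.

Local Open Scope classical_set_scope.
Local Open Scope card_scope.
Local Open Scope group_scope.
Local Open Scope quotient_scope.

Definition is_subgroup (G : groupType) (H : set G) : Prop :=
  [/\ H 1, forall x y, H x -> H y -> H (x * y) & forall x, H x -> H x^-1].

Definition finitely_generated (G : groupType) : Prop :=
  exists A : set G, finite_set A /\ smallest (@is_subgroup G) A = [set: G].

Record normal_subgroup (G : groupType) := NormalSubgroup {
  normal_set : set G;
  normal_is_subgroup : is_subgroup normal_set;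
  normalJ : forall x y, normal_set x -> normal_set (x ^ y)
}.

Section Quotient.
Context {G : groupType} (N : normal_subgroup G).

Definition coset_rel : rel G := fun x y => `[< normal_set N (x^-1 * y) >].

Lemma coset_rel_refl : reflexive coset_rel.
Proof.
by move=> x; apply/asboolP; rewrite mulVg; case: (normal_is_subgroup N).
Qed.

Lemma coset_rel_sym : symmetric coset_rel.
Proof.
suff le x y : coset_rel x y -> coset_rel y x by move=> x y; apply/idP/idP; exact: le.
have [_ _ NV] := normal_is_subgroup N.
by move=> /asboolP/NV; rewrite invgM invgK => ?; apply/asboolP.
Qed.

Lemma coset_rel_trans : transitive coset_rel.
Proof.
have [_ NM _] := normal_is_subgroup N.
move=> y x z /asboolP xy /asboolP yz; apply/asboolP.
by move: (NM _ _ xy yz); rewrite -mulgA mulVKg.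
Qed.

Canonical coset_equiv : equiv_rel G :=
  EquivRel coset_rel coset_rel_refl coset_rel_sym coset_rel_trans.

Definition quotient : Type := {eq_quot coset_rel}.

HB.instance Definition _ : EqQuotient G coset_rel quotient :=
  EqQuotient.on quotient.
HB.instance Definition _ := Choice.on quotient.

Definition quot_pi (x : G) : quotient := \pi_quotient x.

Definition quot_one : quotient := quot_pi 1.
Definition quot_mul (a b : quotient) : quotient := quot_pi (repr a * repr b).
Definition quot_inv (a : quotient) : quotient := quot_pi (repr a)^-1.

Lemma repr_coset x : normal_set N (x^-1 * repr (quot_pi x)).
Proof. by apply/asboolP; rewrite -/(coset_rel _ _) -(eqquotE quotient) reprK. Qed.

Lemma eq_coset x y : normal_set N (x^-1 * y) -> quot_pi x = quot_pi y.
Proof. by move=> Nxy; apply/eqquotP/asboolP. Qed.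

Lemma quot_mulE x y :
  quot_mul (quot_pi x) (quot_pi y) = quot_pi (x * y).
Proof.
apply/esym/eq_coset.
have [_ NM _] := normal_is_subgroup N.
have Nx := repr_coset x; have Ny := repr_coset y.
set a := repr _ in Nx *; set b := repr _ in Ny *.
suff -> : (x * y)^-1 * (a * b) = (x^-1 * a) ^ y * (y^-1 * b).
  by apply: NM => //; exact: normalJ.
by rewrite conjgE invgM !mulgA mulgK.
Qed.

Lemma quot_invE x : quot_inv (quot_pi x) = quot_pi x^-1.
Proof.
have [_ _ NV] := normal_is_subgroup N.
apply/esym/eq_coset; have Nx := repr_coset x.
set a := repr _ in Nx *.
suff -> : x^-1^-1 * a^-1 = (x^-1 * a)^-1 ^ x^-1 by exact/normalJ/NV.
by rewrite conjgE invgM !invgK !mulgA mulgK.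
Qed.

Lemma quot_piP a : exists x, a = quot_pi x.
Proof. by exists (repr a); rewrite /quot_pi reprK. Qed.

Lemma quot_mulA : associative quot_mul.
Proof.
move=> a b c; have [x ->] := quot_piP a; have [y ->] := quot_piP b.
have [z ->] := quot_piP c.
by rewrite (quot_mulE y) (quot_mulE x y) !quot_mulE mulgA.
Qed.

Lemma quot_mul1g : left_id quot_one quot_mul.
Proof. by move=> a; have [x ->] := quot_piP a; rewrite quot_mulE mul1g. Qed.

Lemma quot_mulg1 : right_id quot_one quot_mul.
Proof. by move=> a; have [x ->] := quot_piP a; rewrite quot_mulE mulg1. Qed.

Lemma quot_mulVg : left_inverse quot_one quot_inv quot_mul.
Proof.
by move=> a; have [x ->] := quot_piP a; rewrite quot_invE quot_mulE mulVg.
Qed.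

Lemma quot_mulgV : right_inverse quot_one quot_inv quot_mul.
Proof.
by move=> a; have [x ->] := quot_piP a; rewrite quot_invE quot_mulE mulgV.
Qed.

HB.instance Definition _ := isGroup.Build quotient
  quot_mulA quot_mul1g quot_mulg1 quot_mulVg quot_mulgV.

End Quotient.

Definition isomorphic (G H : groupType) : Prop :=
  exists f : {multiplicative G -> H}, bijective f.

Definition has_quotient (G H : groupType) : Prop :=
  exists N : normal_subgroup G, isomorphic (quotient N) H.

Definition chiF (G : groupType) : set nat :=
  [set n | exists N : normal_subgroup G, [set: quotient N] #= `I_n].

Definition Cinfty : groupType := Algebra.to_multiplicative int.

(* The pair (a, s) stands for a * t ^ s, where t generates C_2, represented by
   (bool, (+)), and t acts on the integers by inversion. *)
Definition Dinfty : Type := (int * bool)%type.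

Section InfiniteDihedral.
Local Open Scope ring_scope.

Definition dih_act (s : bool) (a : int) : int := if s then - a else a.

Definition dih_one : Dinfty := (0, false).
Definition dih_mul (u v : Dinfty) : Dinfty :=
  (u.1 + dih_act u.2 v.1, u.2 (+) v.2).
Definition dih_inv (u : Dinfty) : Dinfty := (- dih_act u.2 u.1, u.2).

Lemma dih_mulA : associative dih_mul.
Proof.
by move=> [a [|]] [b [|]] [c [|]]; rewrite /dih_mul /= ?opprD ?opprK ?addrA.
Qed.

Lemma dih_mul1g : left_id dih_one dih_mul.
Proof. by move=> [a s]; rewrite /dih_mul /= add0r. Qed.

Lemma dih_mulg1 : right_id dih_one dih_mul.
Proof. by move=> [a [|]]; rewrite /dih_mul /= ?oppr0 addr0. Qed.

Lemma dih_mulVg : left_inverse dih_one dih_inv dih_mul.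
Proof. by move=> [a [|]]; rewrite /dih_mul /= ?opprK ?subrr ?addNr. Qed.

Lemma dih_mulgV : right_inverse dih_one dih_inv dih_mul.
Proof. by move=> [a [|]]; rewrite /dih_mul /= ?opprK ?subrr. Qed.

HB.instance Definition _ := Choice.on Dinfty.
HB.instance Definition _ := isGroup.Build Dinfty
  dih_mulA dih_mul1g dih_mulg1 dih_mulVg dih_mulgV.

End InfiniteDihedral.

Definition has_natural_density (R : realType) (X : set nat) (c : R) : Prop :=
  ((count (fun k => k \in X) (iota 1 n))%:R / n%:R : R)%R @[n --> \oo] --> c.

Definition exactly_one (P Q S : Prop) : Prop :=
  (P \/ Q \/ S) /\ [/\ ~ (P /\ Q), ~ (P /\ S) & ~ (Q /\ S)].

(* Main.v *)
(** Let [G] have no infinite cyclic quotient and let [Q] be a quotient of [G] of order [n].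
    For almost all [n] there is a large prime [p] dividing [n] exactly once such that no
    divisor [d > 1] of [n] is [1] mod [p]; moreover [p] can be found in any set of primes
    which has enough reciprocals.  By Sylow's theorem [Q] then has a normal Sylow
    [p]-subgroup of order [p], by Schur-Zassenhaus it has a complement, and so [G] maps to
    the affine group of [F_p] with a nontrivial translation in the image.  Writing the map
    as [g |-> (x |-> a g * x + c g)], the character [a] takes values in the group of
    [D]-th roots of unity, where [D] is a constant of [G]: linear algebra over [Z] on the
    relations of [G] shows that abelian quotients are killed by some [D > 0].  So if [p] is
    neither [1] mod [4] nor [1] mod an odd prime divisor of [D], then [a = 1] or [-1].
    Since [p > D], [a = 1] is impossible; hence [n] is even, and [c] is a non-principal
    crossed homomorphism to [F_p] with signs.  As [p] is large, it comes from such a crossed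
    homomorphism to [Z], which is the same as an infinite dihedral quotient.

    That the primes [p] with [p <> 1] mod [4] and mod finitely many odd primes [q] have
    enough reciprocals follows from Mertens' method: products of the character mod [4] and
    of Legendre symbols are nontrivial real characters [chi], and [L(1, chi) <> 0]. *)

Require Import Defs.
From HB Require Import structures.
From mathcomp Require Import all_boot all_order all_algebra.
From mathcomp Require Import all_classical all_reals all_analysis.
From mathcomp Require Import all_fingroup all_solvable finfield.
From mathcomp Require Import ring lra zify.

Set Implicit Arguments.
Unset Strict Implicit.
Unset Printing Implicit Defensive.

Import Order.TTheory GRing.Theory Num.Theory.

Local Open Scope classical_set_scope.
Local Open Scope ring_scope.

(** * Real characters and [L(1, chi)] *)

Lemma abel_sum (R : comRingType) (a f : nat -> R) (i j : nat) : (i <= j)%N ->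
  \sum_(i <= n < j) a n * f n = (\sum_(i <= n < j) a n) * f j +
    \sum_(i <= n < j) (\sum_(i <= m < n.+1) a m) * (f n - f n.+1).
Proof.
elim: j => [|j IH]; first by rewrite leqn0 => /eqP->; rewrite !big_geq// mul0r add0r.
rewrite leq_eqVlt => /predU1P[->|]; first by rewrite !big_geq// mul0r add0r.
rewrite ltnS => ij; rewrite big_nat_recr//= IH//.
rewrite [X in _ = _ + X]big_nat_recr//=.
rewrite [X in X * f j.+1]big_nat_recr//= (big_nat_recr j)//=; ring.
Qed.

(** After summation by parts all partial sums of [a] are at most [C] in size, and the nonnegative
    weights [f j] and [f n - f n.+1] telescope to [f i]. *)
Lemma abel_bound (R : realFieldType) (a f : nat -> R) (C : R) (i j : nat) :
  (forall k, `|\sum_(i <= n < k) a n| <= C) ->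
  (forall n, (i <= n)%N -> 0 <= f n.+1 <= f n) ->
  `|\sum_(i <= n < j) a n * f n| <= C * f i.
Proof.
move=> aC fP.
have C0 : 0 <= C by apply: le_trans (aC 0%N); exact: normr_ge0.
have fi0 n : (i <= n)%N -> 0 <= f n.
  by move=> /fP/andP[]; exact: le_trans.
have [ji|ij] := leqP j i; first by rewrite big_geq// normr0 mulr_ge0// fi0.
rewrite abel_sum 1?ltnW//.
apply: (@le_trans _ _ (C * f j + \sum_(i <= n < j) C * (f n - f n.+1))).
  apply: le_trans (ler_normD _ _) _; apply: lerD.
    by rewrite normrM ler_pM// (ger0_norm (fi0 _ _))// ltnW.
  apply: le_trans (ler_norm_sum _ _ _) _.
  rewrite !big_nat; apply: ler_sum => n /andP[ni nj].
  have /andP[_ fn] := fP _ ni.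
  by rewrite normrM ler_pM// ger0_norm// subr_ge0.
rewrite -mulr_sumr (eq_bigr (fun n => - f n.+1 - - f n)); last by move=> n _; rewrite opprK addrC.
by rewrite telescope_sumr 1?ltnW// -mulrDr (_ : f j + _ = f i)//; ring.
Qed.

(** An abstract nonprincipal real Dirichlet character: complete multiplicativity is kept, and
    bounded sums over intervals take the place of periodicity. *)
Definition quadratic_char (R : realFieldType) (chi : nat -> R) (C : R) :=
  [/\ chi 1%N = 1, forall m n, chi (m * n)%N = chi m * chi n,
      forall n, [\/ chi n = 0, chi n = 1 | chi n = -1] &
      forall i j, `|\sum_(i <= n < j) chi n| <= C].

Definition divisor_sum (R : realFieldType) (chi : nat -> R) (n : nat) : R :=
  \sum_(d <- divisors n) chi d.

(** The divisors of [a * b] are the products of a divisor of [a] and one of [b]; [gcdn] with [a] and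
    with [b] recovers the two factors. *)
Lemma divisor_sum_coprime (R : realFieldType) (chi : nat -> R) (C : R) (a b : nat) :
  quadratic_char chi C -> (0 < a)%N -> (0 < b)%N -> coprime a b ->
  divisor_sum chi (a * b) = divisor_sum chi a * divisor_sum chi b.
Proof.
move=> [_ chiM _ _] a0 b0 ab.
rewrite /divisor_sum big_distrl/=.
have inj x y : x \in divisors a -> y \in divisors b -> gcdn (x * y) a = x.
  rewrite -!dvdn_divisors// => xa yb.
  rewrite gcdnC Gauss_gcdl; last exact: coprime_dvdr yb ab.
  by rewrite gcdnC; apply/gcdn_idPl.
have inj2 x y : x \in divisors a -> y \in divisors b -> gcdn (x * y) b = y.
  rewrite -!dvdn_divisors// => xa yb.
  rewrite gcdnC Gauss_gcdr; last by rewrite coprime_sym; exact: coprime_dvdl xa ab.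
  by rewrite gcdnC; apply/gcdn_idPl.
have U : uniq [seq (x * y)%N | x <- divisors a, y <- divisors b].
  apply: allpairs_uniq; try exact: divisors_uniq.
  move=> [x y] [x' y'] /=.
  move=> /allpairsP[[u v] /= [ua vb [-> ->]]] /allpairsP[[u' v'] /= [ua' vb' [-> ->]]] e.
  have -> : u = u' by rewrite -(inj u v)// e inj.
  by have -> : v = v' by rewrite -(inj2 u v)// e inj2.
have P : perm_eq (divisors (a * b)) [seq (x * y)%N | x <- divisors a, y <- divisors b].
  apply: uniq_perm => //; first exact: divisors_uniq.
  move=> d; rewrite -dvdn_divisors ?muln_gt0 ?a0//.
  apply/idP/allpairsP => [dab|[[x y] /= [xa yb ->]]].
    exists (gcdn d a, gcdn d b) => /=.
    rewrite -!dvdn_divisors// !dvdn_gcdr; split=> //.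
    apply/eqP; rewrite eqn_dvd; apply/andP; split.
      rewrite muln_gcdl !muln_gcdr !dvdn_gcd (dvdn_mulr _ (dvdnn d))/=.
      by rewrite (dvdn_mull _ (dvdnn d)) (dvdn_mulr _ (dvdnn d)).
    rewrite Gauss_dvd ?dvdn_gcdl//.
    by apply: coprime_dvdl (dvdn_gcdr _ _) _; apply: coprime_dvdr (dvdn_gcdr _ _) _.
  by move: xa yb; rewrite -!dvdn_divisors//; exact: dvdn_mul.
rewrite (perm_big _ P) big_allpairs_dep; apply: eq_bigr => x _.
by rewrite big_distrr; apply: eq_bigr => y _; rewrite chiM.
Qed.

Lemma divisor_sum_pfactor (R : realFieldType) (chi : nat -> R) (C : R) (p k : nat) :
  quadratic_char chi C -> prime p ->
  divisor_sum chi (p ^ k) = \sum_(0 <= j < k.+1) chi p ^+ j.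
Proof.
move=> [chi1 chiM _ _] pp.
have P : perm_eq (divisors (p ^ k)) [seq (p ^ j)%N | j <- iota 0 k.+1].
  apply: uniq_perm; first exact: divisors_uniq.
    rewrite map_inj_uniq ?iota_uniq// => i j /eqP.
    by rewrite eqn_exp2l ?prime_gt1// => /eqP.
  move=> d; rewrite -dvdn_divisors ?expn_gt0 ?prime_gt0//.
  apply/dvdn_pfactor/mapP => // -[j jk ->]; exists j => //.
    by rewrite mem_iota.
  by move: jk; rewrite mem_iota.
rewrite /divisor_sum (perm_big _ P) big_map /index_iota subn0.
apply: eq_bigr => j _; elim: j => [|j IH]; first by rewrite expr0.
by rewrite expnS chiM IH exprS.
Qed.

(** Induction on [n], splitting off the full power [p ^ k] of the least prime factor. The local
    factor is 1, [k + 1], or an alternating sum equal to 1 for even [k] and 0 for odd [k]; a square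
    has only even exponents. *)
Lemma divisor_sum_ge (R : realFieldType) (chi : nat -> R) (C : R) (n : nat) :
  quadratic_char chi C -> (0 < n)%N ->
  0 <= divisor_sum chi n /\ ((exists k, n = k ^ 2)%N -> 1 <= divisor_sum chi n).
Proof.
move=> chiC; move: (chiC) => [chi1 chiM chiE _].
elim/ltn_ind: n => n IH n0.
have [->|n1] := eqVneq n 1%N.
  by rewrite /divisor_sum big_seq1 chi1; split=> //; exact: ler01.
have pp : prime (pdiv n) by apply: pdiv_prime; case: n n0 n1 {IH} => [|[]].
set p := pdiv n in pp; set k := logn p n; set m := (n %/ p ^ k)%N.
have nE : n = (p ^ k * m)%N by rewrite mulnC divnK// pfactor_dvdnn.
have k0 : (0 < k)%N by rewrite logn_gt0 mem_primes pp n0 pdiv_dvd.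
have m0 : (0 < m)%N by move: n0; rewrite nE muln_gt0 => /andP[].
have pk1 : (1 < p ^ k)%N by rewrite -(exp1n k) ltn_exp2r// prime_gt1.
have mn : (m < n)%N by rewrite nE ltn_Pmull.
have cop : coprime (p ^ k) m.
  have [m' m'p e] := pfactor_coprime pp n0.
  rewrite -/k in e; have -> : m = m' by rewrite /m e mulnK// (ltn_trans _ pk1).
  by rewrite coprimeXl.
have [fm0 fm1] := IH m mn m0.
have -> : divisor_sum chi n = divisor_sum chi (p ^ k) * divisor_sum chi m.
  by rewrite [in LHS]nE (divisor_sum_coprime chiC)// expn_gt0 prime_gt0.
rewrite (divisor_sum_pfactor k chiC pp).
have geo : 0 <= \sum_(0 <= j < k.+1) chi p ^+ j /\
    (~~ odd k -> 1 <= \sum_(0 <= j < k.+1) chi p ^+ j).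
  case: (chiE p) => ->.
  - rewrite big_nat_recl// expr0 big1 ?addr0; first by split=> //; exact: ler01.
    by move=> i _; rewrite expr0n.
  - split=> [|_]; first by apply: sumr_ge0 => i _; rewrite expr1n ler01.
    rewrite big_nat_recl// expr0 lerDl; apply: sumr_ge0 => i _.
    by rewrite expr1n ler01.
  - have -> : \sum_(0 <= j < k.+1) (-1) ^+ j = (~~ odd k)%:R :> R.
      elim: k {m nE k0 m0 pk1 mn cop fm0 fm1} => [|k IHk]; first by rewrite big_nat1.
      rewrite big_nat_recr//= IHk -signr_odd/=.
      by case: (odd k); rewrite /= ?expr0 ?expr1 ?add0r ?subrr.
    by case: (odd k) => /=.
split=> [|[l nl]]; first by rewrite mulr_ge0//; case: geo.
have l0 : (0 < l)%N by move: n0; rewrite nl expn_gt0 orbF.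
have ek : k = (logn p l).*2 by rewrite /k nl lognX mul2n.
have [_] := geo; rewrite ek odd_double -ek => /(_ isT) g1.
rewrite -[1]mul1r ler_pM ?ler01//; apply: fm1.
exists (l %/ p ^ logn p l)%N.
have pl := pfactor_dvdnn p l.
apply/eqP; rewrite -(eqn_pmul2l (ltnW pk1)) -nE [in X in X == _]nl.
by rewrite ek -muln2 expnM -expnMn mulnC divnK.
Qed.

Lemma sum_multiples (V : nmodType) (F : nat -> V) (d N : nat) : (0 < d)%N ->
  \sum_(1 <= n < N.+1 | (d %| n)%N) F n = \sum_(1 <= m < (N %/ d).+1) F (d * m)%N.
Proof.
move=> d0; elim: N => [|N IH]; first by rewrite div0n !big_geq.
rewrite big_mkcond big_nat_recr//= -big_mkcond IH divnS//.
have [dN|dN] := boolP (d %| N.+1)%N; last by rewrite addr0.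
rewrite add1n [RHS]big_nat_recr//=; congr (_ + F _).
have -> : (N %/ d).+1 = (N.+1 %/ d)%N by rewrite divnS// dN.
by rewrite mulnC divnK.
Qed.

(** * Geometric sums and truncated Lambert series *)

Definition geom (R : pzRingType) (t : R) (d : nat) : R := \sum_(0 <= i < d) t ^+ i.

Lemma geomM (R : comRingType) (t : R) (d : nat) : (1 - t) * geom t d = 1 - t ^+ d.
Proof.
rewrite /geom; elim: d => [|d IH]; first by rewrite big_geq// mulr0 expr0 subrr.
by rewrite big_nat_recr//= mulrDr IH exprS; ring.
Qed.

Lemma geomS (R : pzRingType) (t : R) (d : nat) : geom t d.+1 = 1 + t * geom t d.
Proof.
rewrite /geom big_nat_recl// expr0 mulr_sumr; congr (_ + _).
by apply: eq_bigr => i _; rewrite exprS.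
Qed.

(** When [b > d], put [e = b - d]: then [a <= d - e], and [t ^ (d - e) + t ^ (d + e) - 2 * t ^ d] is
    [t ^ (d - e)] times the square of [1 - t ^ e]. *)
Lemma exprD_mid (R : realFieldType) (t : R) (a b d : nat) : 0 <= t <= 1 ->
  (a + b <= d.*2)%N -> 2 * t ^+ d <= t ^+ a + t ^+ b.
Proof.
move=> /andP[t0 t1].
wlog ab : a b / (a <= b)%N.
  move=> H; case: (leqP a b) => [/H//|/ltnW ba]; rewrite addnC => abd.
  by rewrite addrC; exact: H.
move=> abd.
have tle i j : (i <= j)%N -> t ^+ j <= t ^+ i by move=> ij; exact: ler_wiXn2l.
have [bd|db] := leqP b d.
  by have := tle _ _ bd; have := tle _ _ (leq_trans ab bd); lra.
pose e := (b - d)%N.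
have ed : (e <= d)%N by rewrite /e; lia.
have be : b = (d - e + e + e)%N by rewrite /e; lia.
have -> : d = (d - e + e)%N by lia.
have /tle : (a <= d - e)%N by rewrite /e; lia.
rewrite be !exprD; have := exprn_ge0 (d - e) t0; have := exprn_ge0 e t0.
move: (t ^+ (d - e)) (t ^+ e) (t ^+ a) => x y z y0 x0 zx.
have : 0 <= x * (1 - y) ^+ 2 by rewrite mulr_ge0// sqr_ge0.
by nra.
Qed.

(* Pair the terms [t ^ (i + j)] and [t ^ (2 d - 1 - i - j)] of the product. *)
Lemma geom_ge (R : realFieldType) (t : R) (d : nat) : 0 <= t <= 1 ->
  d%:R * d.+1%:R * t ^+ d <= geom t d * geom t d.+1.
Proof.
move=> t01; rewrite /geom !big_mkord.
have E : (\sum_(i < d) t ^+ i) * (\sum_(i < d.+1) t ^+ i) =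
         \sum_(i < d) \sum_(j < d.+1) t ^+ (i + j).
  rewrite mulr_suml; apply: eq_bigr => i _; rewrite mulr_sumr.
  by apply: eq_bigr => j _; rewrite exprD.
have E' : (\sum_(i < d) t ^+ i) * (\sum_(i < d.+1) t ^+ i) =
         \sum_(i < d) \sum_(j < d.+1) t ^+ ((d - i.+1) + (d - j)).
  rewrite (reindex_inj rev_ord_inj)/= mulr_suml; apply: eq_bigr => i _.
  rewrite (reindex_inj rev_ord_inj)/= mulr_sumr; apply: eq_bigr => j _.
  by rewrite exprD subSS.
suff : 2 * (d%:R * d.+1%:R * t ^+ d) <= \sum_(i < d) (\sum_(j < d.+1) t ^+ (i + j)
    + \sum_(j < d.+1) t ^+ (d - i.+1 + (d - j))).
  by rewrite big_split/= -E -E'; lra.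
have -> : 2 * (d%:R * d.+1%:R * t ^+ d) = \sum_(i < d) \sum_(j < d.+1) (2 * t ^+ d).
  by rewrite !sumr_const !card_ord -mulrnA -[RHS]mulr_natl natrM; ring.
apply: ler_sum => i _; rewrite -big_split/=; apply: ler_sum => j _.
by apply: exprD_mid => //; have := ltn_ord i; have := ltn_ord j; lia.
Qed.

Definition Lsum (R : realFieldType) (chi : nat -> R) (N : nat) : R :=
  \sum_(1 <= n < N.+1) chi n / n%:R.

Lemma quadratic_charC_ge0 (R : realFieldType) (chi : nat -> R) (C : R) :
  quadratic_char chi C -> 0 <= C.
Proof. by move=> [_ _ _ /(_ 0 0)%N]; apply: le_trans; exact: normr_ge0. Qed.

Lemma quadratic_char_norm (R : realFieldType) (chi : nat -> R) (C : R) (n : nat) :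
  quadratic_char chi C -> `|chi n| <= 1.
Proof.
by move=> [_ _ /(_ n)[]-> _]; rewrite ?normr0 ?normrN ?normr1 ?ler01.
Qed.

(** The weight is [1 - t] times [1 / (n * (1 - t)) - t ^ n / (1 - t ^ n)]. It is nonnegative because
    each of the [n] terms of [geom t n] is at least [t ^ n]. Consecutive weights differ by [1 / (n *
    (n + 1)) - t ^ n / (geom t n * geom t n.+1)], which [geom_ge] controls. *)
Lemma lambert_weight (R : realFieldType) (t : R) (n : nat) : 0 < t < 1 -> (0 < n)%N ->
  0 <= n.+1%:R^-1 - t ^+ n.+1 / geom t n.+1 <= n%:R^-1 - t ^+ n / geom t n.
Proof.
move=> /andP[t0 t1] n0.
have g0 m : (0 < m)%N -> 0 < geom t m.
  case: m => // m _; rewrite geomS ltr_pwDl// mulr_ge0 ?(ltW t0)//.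
  by rewrite /geom; apply: sumr_ge0 => i _; exact/exprn_ge0/ltW.
have gm m : m%:R * t ^+ m <= geom t m.
  rewrite /geom mulr_natl -[X in _ *+ X]subn0 -sumr_const_nat !big_nat.
  by apply: ler_sum => i /andP[_ im]; apply: ler_wiXn2l; rewrite ?(ltW t0) ?(ltW t1) ?(ltnW im).
apply/andP; split.
  rewrite subr_ge0 ler_pdivrMr ?g0// mulrC ler_pdivlMr ?ltr0n// mulrC.
  exact: gm.
rewrite -subr_ge0.
have gn := g0 _ n0; have gn1 := g0 _ (ltn0Sn n).
have nn : n%:R != 0 :> R by rewrite pnatr_eq0 -lt0n.
have nn1 : n.+1%:R != 0 :> R by rewrite pnatr_eq0.
have -> : n%:R^-1 - t ^+ n / geom t n - (n.+1%:R^-1 - t ^+ n.+1 / geom t n.+1) =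
    (n%:R * n.+1%:R)^-1 - t ^+ n / (geom t n * geom t n.+1).
  rewrite [in RHS](_ : t ^+ n = t ^+ n * (geom t n.+1 - t * geom t n)); last first.
    by rewrite geomS addrK mulr1.
  rewrite exprS -(natr1 n) in nn1 *.
  by field; rewrite nn nn1 !gt_eqF.
rewrite subr_ge0 ler_pdivrMr ?mulr_gt0// mulrC ler_pdivlMr ?mulr_gt0 ?ltr0n//.
by rewrite mulrC geom_ge// !ltW.
Qed.

(* Monsky's argument.  The Lambert series [sum chi n * t ^ n / (1 - t ^ n)] equals
   [sum divisor_sum chi n * t ^ n], which dominates [sum t ^ (k ^ 2)]; if [L(1, chi) = 0],
   it is also [- sum chi n * (1 / (n * (1 - t)) - t ^ n / (1 - t ^ n))], which is bounded
   as the weights decrease to [0].  Here the series are truncated at [D] and multiplied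
   by [1 - t]. *)
Lemma lambert_squares (R : realFieldType) (chi : nat -> R) (C t : R) (K D : nat) :
  quadratic_char chi C -> 0 < t < 1 -> (forall N, `|Lsum chi N| <= C / N.+1%:R) ->
  (K ^ 2 <= D)%N ->
  (1 - t) * \sum_(1 <= k < K.+1) t ^+ (k ^ 2) <=
    (1 - t) * C + C / D.+1%:R + D%:R * t ^+ D + (1 - t) * (D%:R ^+ 2 * t ^+ D).
Proof.
move=> chiC t01 LC KD; have /andP[t0 t1] := t01.
have [chi1 chiM chiE chiS] := chiC.
have t0' := ltW t0; have t1' := ltW t1.
have tX n : 0 <= t ^+ n by exact: exprn_ge0.
have g1 m : (0 < m)%N -> 1 <= geom t m.
  by case: m => // m _; rewrite geomS lerDl mulr_ge0// sumr_ge0.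
(* Abel summation against the decreasing weights costs [C] times the first of them, [1 - t]; what
   remains is [Lsum chi D], small by assumption. *)
have step1 : `|\sum_(1 <= d < D.+1) chi d * (t ^+ d / geom t d)| <=
    (1 - t) * C + C / D.+1%:R.
  pose w n := n%:R^-1 - t ^+ n / geom t n.
  have := @abel_bound _ chi w C 1 D.+1 (chiS 1%N) (fun n n0 => lambert_weight t01 n0).
  rewrite {2}/w invr1 expr1 /geom big_nat1 expr0 divr1 [C * _]mulrC => H.
  have -> : \sum_(1 <= d < D.+1) chi d * (t ^+ d / geom t d) =
      Lsum chi D - \sum_(1 <= n < D.+1) chi n * w n.
    by rewrite /Lsum -sumrB; apply: eq_bigr => n _; rewrite /w; ring.
  apply: le_trans (ler_normB _ _) _; rewrite addrC lerD//; exact: LC.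
(* Cutting the inner geometric series at [D] loses at most [t ^ D] for each [d]. *)
have step2 : `|(1 - t) * \sum_(1 <= d < D.+1) chi d * \sum_(1 <= m < D.+1) t ^+ (d * m)|
    <= (1 - t) * C + C / D.+1%:R + D%:R * t ^+ D.
  rewrite mulr_sumr.
  rewrite (eq_bigr (fun d => (1 - t) * (chi d * \sum_(1 <= m < D.+1) t ^+ (d * m))
    - chi d * (t ^+ d / geom t d) + chi d * (t ^+ d / geom t d))); last by move=> d _; ring.
  rewrite big_split/= addrC; apply: le_trans (ler_normD _ _) _; apply: lerD => //.
  apply: le_trans (ler_norm_sum _ _ _) _.
  have -> : D%:R * t ^+ D = \sum_(1 <= d < D.+1) t ^+ D.
    by rewrite sumr_const_nat subn1 mulr_natl.
  rewrite !big_nat; apply: ler_sum => d /andP[d0 dD].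
  have gd := g1 _ d0; have gd0 : 0 < geom t d by exact: lt_le_trans gd.
  have -> : (1 - t) * (chi d * \sum_(1 <= m < D.+1) t ^+ (d * m)) -
      chi d * (t ^+ d / geom t d) = - (chi d * (t ^+ (d * D) * (t ^+ d / geom t d))).
    have := geomM (t ^+ d) D; have := geomM t d.
    have -> : \sum_(1 <= m < D.+1) t ^+ (d * m) = t ^+ d * geom (t ^+ d) D.
      rewrite /geom big_add1 mulr_sumr/=; apply: eq_bigr => i _.
      by rewrite -exprM -exprD mulnS.
    rewrite -exprM => e1 e2.
    have ->: t ^+ (d * D) = 1 - (1 - t ^+ d) * geom (t ^+ d) D by rewrite e2; ring.
    by rewrite -e1; field; rewrite gt_eqF.
  rewrite normrN normrM (ger0_norm (mulr_ge0 _ (divr_ge0 _ _)))//; last exact: ltW.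
  have tg0 : 0 <= t ^+ d / geom t d by rewrite divr_ge0// ltW.
  rewrite -[leRHS]mul1r; apply: ler_pM => //; first exact: mulr_ge0.
    exact: quadratic_char_norm chiC.
  rewrite -[leRHS]mulr1; apply: ler_pM => //.
    by rewrite ler_wiXn2l// leq_pmull.
  by rewrite ler_pdivrMr// mul1r; apply: le_trans gd; exact: exprn_ile1.
have step3 : \sum_(1 <= n < D.+1) t ^+ n * divisor_sum chi n =
    \sum_(1 <= d < D.+1) chi d * \sum_(1 <= m < (D %/ d).+1) t ^+ (d * m).
  rewrite [RHS]big_nat [RHS](eq_bigr (fun d => \sum_(1 <= n < D.+1 | (d %| n)%N) chi d * t ^+ n)).
    rewrite -big_nat (exchange_big_dep predT)//=.
    rewrite !big_nat; apply: eq_bigr => n /andP[n0 nD].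
    rewrite /divisor_sum mulr_sumr.
    have P : perm_eq (divisors n) [seq d <- index_iota 1 D.+1 | (d %| n)%N].
      apply: uniq_perm; rewrite ?divisors_uniq ?filter_uniq ?iota_uniq//.
      move=> d; rewrite mem_filter -dvdn_divisors// mem_index_iota.
      have [dn|//] := boolP (d %| n)%N; rewrite (dvdn_gt0 n0 dn)//=.
      by symmetry; apply: leq_ltn_trans nD; exact: dvdn_leq.
    by rewrite (perm_big _ P) big_filter; apply: eq_bigr => d _; rewrite mulrC.
  move=> d /andP[d0 _]; rewrite -mulr_sumr; congr (_ * _).
  by rewrite (sum_multiples (fun n => t ^+ n)).
(* The double sums agree on the pairs with [d * m <= D]; at most [D ^ 2] pairs remain, each
   contributing at most [t ^ D]. *)
have step4 : `|\sum_(1 <= d < D.+1) chi d * \sum_(1 <= m < (D %/ d).+1) t ^+ (d * m)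
     - \sum_(1 <= d < D.+1) chi d * \sum_(1 <= m < D.+1) t ^+ (d * m)| <= D%:R ^+ 2 * t ^+ D.
  rewrite -sumrB; apply: le_trans (ler_norm_sum _ _ _) _.
  have -> : D%:R ^+ 2 * t ^+ D = \sum_(1 <= d < D.+1) \sum_(1 <= m < D.+1) t ^+ D.
    by rewrite !sumr_const_nat subn1 -mulrnA -[RHS]mulr_natl natrM.
  rewrite big_nat [leRHS]big_nat; apply: ler_sum => d /andP[d0 dD].
  have Dd : (D %/ d <= D)%N by exact: leq_div.
  rewrite -mulrBr [X in _ - X](big_cat_nat _ (n := (D %/ d).+1))//= opprD addNKr normrM normrN.
  rewrite -[leRHS]mul1r ler_pM ?(quadratic_char_norm d chiC)//.
  rewrite ger0_norm; last by apply: sumr_ge0.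
  rewrite [leRHS](big_cat_nat _ (n := (D %/ d).+1))//=.
  rewrite -[leLHS]add0r; apply: lerD; first exact: sumr_ge0.
  rewrite !big_nat; apply: ler_sum => m /andP[m1 m2].
  by rewrite ler_wiXn2l// ltnW// mulnC -ltn_divLR.
have step5 : \sum_(1 <= k < K.+1) t ^+ (k ^ 2) <= \sum_(1 <= n < D.+1) t ^+ n * divisor_sum chi n.
  have k2 k : (0 < k)%N -> (0 < k ^ 2)%N by rewrite expn_gt0 => ->.
  have P : perm_eq [seq n <- index_iota 1 D.+1 | n \in [seq (k ^ 2)%N | k <- index_iota 1 K.+1]]
      [seq (k ^ 2)%N | k <- index_iota 1 K.+1].
    apply: uniq_perm; rewrite ?filter_uniq ?iota_uniq// ?map_inj_uniq ?iota_uniq//.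
      by move=> x y /eqP; rewrite eqn_exp2r// => /eqP.
    move=> n; rewrite mem_filter andb_idr// => /mapP[k + ->].
    rewrite !mem_index_iota expn_gt0 !ltnS => /andP[-> kK]/=.
    by apply: leq_trans KD; rewrite leq_exp2r.
  apply: (@le_trans _ _ (\sum_(n <- index_iota 1 D.+1 |
      n \in [seq (k ^ 2)%N | k <- index_iota 1 K.+1]) t ^+ n * divisor_sum chi n)).
    rewrite -[leRHS]big_filter [leRHS](perm_big _ P) [leRHS]big_map !big_nat; apply: ler_sum => k /andP[k0 _].
    rewrite ler_peMr//; have [_] := @divisor_sum_ge _ chi C (k ^ 2) chiC (k2 k k0).
    by apply; exists k.
  rewrite [leRHS](bigID (mem [seq (k ^ 2)%N | k <- index_iota 1 K.+1]))/= lerDl.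
  rewrite big_seq_cond; apply: sumr_ge0 => n /andP[+ _]; rewrite mem_index_iota => /andP[n0 _].
  by rewrite mulr_ge0//; have [] := divisor_sum_ge chiC n0.
have h0 : 0 <= 1 - t by rewrite subr_ge0.
apply: le_trans (ler_wpM2l h0 step5) _; rewrite step3.
rewrite -[X in _ * X](subrK (\sum_(1 <= d < D.+1) chi d * \sum_(1 <= m < D.+1) t ^+ (d * m))).
rewrite mulrDr addrC; apply: lerD; first exact: le_trans (ler_norm _) step2.
by apply: ler_wpM2l => //; exact: le_trans (ler_norm _) step4.
Qed.

Lemma Lsum_tail (R : realFieldType) (chi : nat -> R) (C : R) (M N : nat) :
  quadratic_char chi C -> (M <= N)%N -> `|Lsum chi N - Lsum chi M| <= C / M.+1%:R.
Proof.
move=> [_ _ _ chiS] MN.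
rewrite /Lsum (big_cat_nat _ (n := M.+1))//= addrAC subrr add0r.
apply: (abel_bound _ (chiS M.+1)) => n Mn.
have n0 : (0 < n)%N by exact: leq_trans Mn.
by rewrite invr_ge0 ler0n/= lef_pV2 ?posrE ?ltr0n// ler_nat.
Qed.

Lemma Lsum_le (R : realFieldType) (chi : nat -> R) (C : R) (N : nat) :
  quadratic_char chi C -> `|Lsum chi N| <= C.
Proof.
move=> chiC; have := Lsum_tail chiC (leq0n N).
by rewrite {2}/Lsum big_geq// subr0 divr1.
Qed.

Lemma bernoulli_ge (R : realFieldType) (h : R) (n : nat) : -1 <= h ->
  1 + n%:R * h <= (1 + h) ^+ n.
Proof.
move=> h1; elim: n => [|n IH]; first by rewrite mul0r addr0 expr0.
rewrite exprS -natr1; have h0 : 0 <= 1 + h by lra.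
apply: le_trans (ler_wpM2l h0 IH); have := ler0n R n; move: (n%:R) => x x0.
by have := mulr_ge0 x0 (sqr_ge0 h); nra.
Qed.

(** Take [D = 3 * E]. Bernoulli's inequality and [(1 - h) * (1 + h) <= 1] bound
    [(1 - h) ^ E * (E * h)] by 1; cubing this bounds [D ^ 2 * (1 - h) ^ D] by [9 / (E * h ^ 3)]. *)
Lemma sqrn_expr_small (R : archiRealFieldType) (h e : R) (D0 : nat) :
  0 < h < 1 -> 0 < e -> exists D, (D0 <= D)%N /\ D%:R ^+ 2 * (1 - h) ^+ D <= e.
Proof.
move=> /andP[h0 h1] e0.
pose E := (D0 + Num.bound (9 / (e * h ^+ 3))).+1.
have E0 : 0 < E%:R :> R by rewrite ltr0n.
have EB : 9 / (e * h ^+ 3) <= E%:R.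
  have B0 : 0 <= 9 / (e * h ^+ 3) by rewrite divr_ge0// mulr_ge0 ?exprn_ge0 ?ltW.
  apply: le_trans (ltW (archi_boundP B0)) _.
  by rewrite ler_nat /E; lia.
exists (3 * E)%N; split; first by rewrite /E; lia.
have tE : (1 - h) ^+ E * (E%:R * h) <= 1.
  have tp : 0 <= (1 - h) ^+ E by apply: exprn_ge0; lra.
  have B : 1 + E%:R * h <= (1 + h) ^+ E by apply: bernoulli_ge; lra.
  have : (1 - h) ^+ E * (1 + h) ^+ E <= 1.
    rewrite -exprMn exprn_ile1//; nra.
  have := ler_wpM2l tp B; lra.
have t0 : 0 <= (1 - h) ^+ E * (E%:R * h).
  by apply: mulr_ge0; [apply: exprn_ge0; lra | apply: mulr_ge0; lra].
have t3 : ((1 - h) ^+ E * (E%:R * h)) ^+ 3 <= 1 by exact: exprn_ile1.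
have : 9 <= E%:R * (e * h ^+ 3) by rewrite -ler_pdivrMr// mulr_gt0// exprn_gt0.
rewrite mulnC exprM natrM; move: ((1 - h) ^+ E) (E%:R) E0 t3 => x y y0 t3 H.
rewrite -(ler_pM2l (exprn_gt0 3 h0)) -(ler_pM2l y0).
have -> : y * (h ^+ 3 * ((y * 3) ^+ 2 * x ^+ 3)) = 9 * (x * (y * h)) ^+ 3 by ring.
lra.
Qed.

(** Let [t = 1 - h] with [h = 1 / (2 * K ^ 2)]. By Bernoulli [t ^ (k ^ 2) >= 1 / 2] for [k <= K], so
    the left side of [lambert_squares] is at least [h * K / 2 >= h * (C + 3)], while for large [D]
    the right side stays below [h * (C + 3)]. *)
Lemma Lsum_not_small (R : archiRealFieldType) (chi : nat -> R) (C : R) :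
  quadratic_char chi C -> ~ (forall N, `|Lsum chi N| <= C / N.+1%:R).
Proof.
move=> chiC LC; have C0 := quadratic_charC_ge0 chiC.
pose K := (Num.bound (2 * C + 6)).+1.
have KC : 2 * C + 6 <= K%:R.
  have B0 : 0 <= 2 * C + 6 by lra.
  by apply: le_trans (ltW (archi_boundP B0)) _; rewrite ler_nat.
have K0 : 0 < K%:R :> R by lra.
pose h : R := (2 * K%:R ^+ 2)^-1.
have K2 : 2 <= 2 * K%:R ^+ 2 :> R by nra.
have h0 : 0 < h by rewrite invr_gt0; lra.
have h1 : h < 1 by rewrite invf_lt1; lra.
have hK : (K ^ 2)%:R * h = 1 / 2 by rewrite /h natrX; field; rewrite gt_eqF.
have [D [KD small]] := @sqrn_expr_small R h (h / 2) (K ^ 2 + Num.bound (C / h)).+1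
  (introT andP (conj h0 h1)) (divr_gt0 h0 (ltr0n _ 2)).
have t01 : 0 < 1 - h < 1 by lra.
have KD' : (K ^ 2 <= D)%N by lia.
have := lambert_squares chiC t01 LC KD'.
have -> : 1 - (1 - h) = h by ring.
have : K%:R / 2 <= \sum_(1 <= k < K.+1) (1 - h) ^+ (k ^ 2).
  have -> : K%:R / 2 = \sum_(1 <= k < K.+1) (1 / 2) :> R.
    by rewrite sumr_const_nat subn1 -mulr_natl; ring.
  rewrite !big_nat; apply: ler_sum => k /andP[k0 kK].
  apply: (@le_trans _ _ ((1 - h) ^+ (K ^ 2))).
    by have := @bernoulli_ge R (- h) (K ^ 2); rewrite mulrN hK; lra.
  rewrite ler_wiXn2l ?leq_exp2r//; lra.
have DC : C / D.+1%:R <= h.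
  rewrite ler_pdivrMr ?ltr0n// mulrC -ler_pdivrMr//.
  have B0 : 0 <= C / h by rewrite divr_ge0// ltW.
  by apply: le_trans (ltW (archi_boundP B0)) _; rewrite ler_nat; lia.
have DD : D%:R * (1 - h) ^+ D <= D%:R ^+ 2 * (1 - h) ^+ D.
  apply: ler_wpM2r; first by apply: exprn_ge0; lra.
  by rewrite expr2 -natrM ler_nat; case: (D) => // n; rewrite leq_pmulr.
have D20 : 0 <= D%:R ^+ 2 * (1 - h) ^+ D.
  by rewrite mulr_ge0 ?exprn_ge0//; lra.
move: (\sum_(_ <= _ < _) _) (D%:R ^+ 2 * _) (D%:R * _) (C / _) DC DD D20 small.
move=> s x y z zh yx x0 xh sK.
have := ler_wpM2l (ltW h0) sK.
have : h * x <= x by rewrite ler_piMl// ltW.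
have : h * (C + 3) <= h * (K%:R / 2) by rewrite ler_pM2l//; lra.
lra.
Qed.

(** This is the usable form of [L(1, chi) <> 0], without passing to a limit: one partial sum
    exceeding its own tail bound keeps all later ones away from 0. *)
Lemma Lsum_away (R : archiRealFieldType) (chi : nat -> R) (C : R) : quadratic_char chi C ->
  exists2 delta : R, 0 < delta & exists N0, forall N, (N0 <= N)%N -> delta <= `|Lsum chi N|.
Proof.
move=> chiC; have := Lsum_not_small chiC.
move=> /existsNP[N0 /negP]; rewrite -ltNge => H.
exists (`|Lsum chi N0| - C / N0.+1%:R); first by rewrite subr_gt0.
exists N0 => N NN.
have := Lsum_tail chiC NN.
have := ler_normB (Lsum chi N) (Lsum chi N - Lsum chi N0); rewrite subKr.
by move: (C / _) => c; lra.
Qed.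

(** * Mertens' theorems *)

Lemma prime_ndvd_fact (p k : nat) : prime p -> (k < p)%N -> ~~ (p %| k`!)%N.
Proof.
move=> pp; elim: k => [|k IH] kp; first by rewrite fact0 dvdn1 neq_ltn prime_gt1 ?orbT.
by rewrite factS Euclid_dvdM// gtnNdvd//= IH// ltnW.
Qed.

Lemma prod_primes_dvd (s : seq nat) (n : nat) : uniq s ->
  {in s, forall p, prime p && (p %| n)%N} -> (\prod_(p <- s) p %| n)%N.
Proof.
elim: s => [|p s IH] /=; first by rewrite big_nil dvd1n.
move=> /andP[ps us] H; rewrite big_cons.
have /andP[pp pn] := H p (mem_head _ _).
have Hs : {in s, forall q, prime q && (q %| n)%N}.
  by move=> q qs; apply: H; rewrite in_cons qs orbT.
rewrite Gauss_dvd ?pn ?IH// prime_coprime//.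
rewrite big_seq; elim/big_rec : _ => [|q m qs IHm].
  by rewrite dvdn1 neq_ltn prime_gt1 ?orbT.
have /andP[qp _] := Hs _ qs.
rewrite Euclid_dvdM// negb_or IHm andbT dvdn_prime2//.
by apply: contra ps => /eqP->.
Qed.

(** The coefficients at [m] and [m.+1] are equal, and together at most the sum [2 ^ m.*2.+1] of
    their row. *)
Lemma bin_odd_middle (m : nat) : ('C(m.*2.+1, m) <= 4 ^ m)%N.
Proof.
have H : (2 ^ m.*2.+1 = \sum_(i < m.*2.+2) 'C(m.*2.+1, i))%N.
  have := expnDn 1 1 m.*2.+1; rewrite addn1 => ->.
  by apply: eq_bigr => i _; rewrite !exp1n !muln1.
have lt1 : (m < m.*2.+2)%N by lia.
have lt2 : (m.+1 < m.*2.+2)%N by lia.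
rewrite (bigD1 (Ordinal lt1))//= (bigD1 (Ordinal lt2))/= in H; last first.
  by rewrite -val_eqE/=; lia.
have e : ('C(m.*2.+1, m.+1) = 'C(m.*2.+1, m))%N.
  by rewrite -(bin_sub (n := m.*2.+1) (m := m)); [congr ('C(_, _))%N; lia|lia].
have : (2 * 'C(m.*2.+1, m) <= 2 ^ m.*2.+1)%N by rewrite H e; lia.
by rewrite expnS leq_pmul2l// -muln2 mulnC expnM.
Qed.

(** Erdos's argument: for [N = 2 * m + 1] all primes from [m + 2] to [N] divide ['C(N, m)], which is
    at most [4 ^ m]; an even [N > 2] is not prime and reduces to [N - 1]. *)
Lemma primorial_le (N : nat) : (\prod_(0 <= p < N.+1 | prime p) p <= 4 ^ N)%N.
Proof.
elim/ltn_ind: N => N IH.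
have [N2|N2] := leqP N 2.
  by case: N N2 {IH} => [|[|[|]]]// _; rewrite big_mkcond !big_nat_recr// big_geq.
have [oN|eN] := boolP (odd N); last first.
  rewrite big_mkcond big_nat_recr//= -big_mkcond/= ifF ?muln1; last first.
    apply: contraNF eN => /even_prime[N_2|//]; by move: N2; rewrite N_2.
  case: N IH N2 eN => // N IH _ _.
  by apply: leq_trans (IH N _) _ => //; rewrite leq_exp2l.
have [m Nm] : exists m, N = m.*2.+1 by exists N./2; rewrite -[LHS]odd_double_half oN.
subst N.
rewrite (big_cat_nat _ (n := m.+2))//=; last by lia.
have -> : (4 ^ m.*2.+1 = 4 ^ m.+1 * 4 ^ m)%N by rewrite -expnD; congr (_ ^ _)%N; lia.
apply: leq_mul; first by apply: IH; lia.
apply: leq_trans (bin_odd_middle m); apply: dvdn_leq.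
  by rewrite bin_gt0; lia.
rewrite -big_filter; apply: prod_primes_dvd; first by rewrite filter_uniq ?iota_uniq.
move=> p; rewrite mem_filter mem_index_iota => /andP[pp /andP[p1 p2]].
rewrite pp/=; have := @bin_fact m.*2.+1 m; have -> : (m.*2.+1 - m = m.+1)%N by lia.
move=> /(_ ltac:(lia)) e.
have : (p %| m.*2.+1`!)%N by apply: dvdn_fact; rewrite prime_gt0//; lia.
rewrite -e Euclid_dvdM// (Euclid_dvdM (m`!))// => /orP[//|/orP[]]; apply: contraTT => _.
  by apply: prime_ndvd_fact => //; lia.
by apply: prime_ndvd_fact => //; lia.
Qed.

(** * Logarithms as sums over prime powers, and Mertens' estimates *)

Lemma logn_count (p n N : nat) : prime p -> (0 < n <= N)%N ->
  logn p n = (\sum_(1 <= k < N.+1) (p ^ k %| n))%N.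
Proof.
move=> pp /andP[n0 nN]; rewrite logn_count_dvd// [RHS](big_cat_nat _ (n := n))//=; last exact: leqW.
rewrite [X in (_ + X)%N]big_nat [X in (_ + X)%N]big1 ?addn0// => k /andP[nk _].
rewrite gtnNdvd//; apply: leq_ltn_trans nk _; exact/ltn_expl/prime_gt1.
Qed.

Lemma ln_prod_nat (R : realType) (s : seq nat) (P : pred nat) (F : nat -> nat) :
  (forall i, P i -> 0 < F i)%N ->
  ln ((\prod_(i <- s | P i) F i)%N%:R : R) = \sum_(i <- s | P i) ln (F i)%:R.
Proof.
move=> F0.
suff [] : (0 < \prod_(i <- s | P i) F i)%N /\
  ln ((\prod_(i <- s | P i) F i)%N%:R : R) = \sum_(i <- s | P i) ln (F i)%:R by [].
elim/big_rec2 : _ => [|i x y Pi [y0 <-]]; first by rewrite ln1.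
rewrite muln_gt0 y0 F0// natrM lnM// posrE ltr0n//; exact: F0.
Qed.

(** This is [ln n] as the sum of the von Mangoldt function over the divisors of [n]. The ranges
    depend on [N] only, so that they can be exchanged with a sum over [n]. *)
Lemma ln_sum_logn (R : realType) (n N : nat) : (0 < n <= N)%N ->
  ln (n%:R : R) = \sum_(0 <= p < N.+1 | prime p)
    \sum_(1 <= k < N.+1 | (p ^ k %| n)%N) ln p%:R.
Proof.
move=> nN; have /andP[n0 nN'] := nN.
have {1}-> : n = (\prod_(0 <= p < N.+1 | prime p) p ^ logn p n)%N.
  rewrite -{1}(partnT n0) (widen_partn _ nN') [RHS]big_mkcond; apply: eq_bigr => p _ /=.
  by rewrite lognE; case: (prime p).
rewrite ln_prod_nat; last by move=> p pp; rewrite expn_gt0 prime_gt0.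
apply: eq_bigr => p pp; rewrite natrX lnXn ?ltr0n ?prime_gt0//.
rewrite (logn_count pp nN) -sumrMnr [RHS]big_mkcond; apply: eq_bigr => k _.
by case: (_ %| _)%N.
Qed.

Lemma sum_ln_exchange (R : realType) (h : nat -> R) (N : nat) :
  \sum_(1 <= n < N.+1) h n * ln n%:R = \sum_(0 <= p < N.+1 | prime p)
    \sum_(1 <= k < N.+1) ln p%:R * \sum_(1 <= m < (N %/ p ^ k).+1) h (p ^ k * m)%N.
Proof.
transitivity (\sum_(1 <= n < N.+1) \sum_(0 <= p < N.+1 | prime p)
    \sum_(1 <= k < N.+1 | (p ^ k %| n)%N) h n * ln p%:R).
  rewrite !big_nat; apply: eq_bigr => n nN.
  rewrite (ln_sum_logn R (N := N))// mulr_sumr; apply: eq_bigr => p pp.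
  by rewrite mulr_sumr.
rewrite exchange_big; apply: eq_bigr => p pp.
rewrite (exchange_big_dep predT)//=; apply: eq_bigr => k _.
rewrite -mulr_suml mulrC; congr (_ * _).
by rewrite (sum_multiples h)// expn_gt0 prime_gt0.
Qed.

Lemma theta_le (R : realType) (N : nat) :
  \sum_(0 <= p < N.+1 | prime p) ln p%:R <= N%:R * ln 4 :> R.
Proof.
rewrite -(@ln_prod_nat R _ prime id); last by move=> p; exact: prime_gt0.
rewrite mulr_natl -lnXn// -natrX ler_ln ?posrE ?ltr0n ?expn_gt0//.
  by rewrite ler_nat primorial_le.
by rewrite prodn_cond_gt0// => p; exact: prime_gt0.
Qed.

Lemma ln_nat_ge0 (R : realType) (n : nat) : 0 <= ln (n%:R : R).
Proof.
case: n => [|n]; first by rewrite ln0.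
by rewrite ln_ge0// ler1n.
Qed.

Lemma ln_natS_le (R : realType) (n : nat) : (0 < n)%N ->
  n%:R * (ln n.+1%:R - ln n%:R) <= 1 :> R.
Proof.
move=> n0; have n0' : 0 < n%:R :> R by rewrite ltr0n.
have -> : n.+1%:R = n%:R * (1 + n%:R^-1) :> R.
  by rewrite -natr1; field; rewrite gt_eqF.
have V0 : 0 < n%:R^-1 :> R by rewrite invr_gt0.
have V1 : 0 < 1 + n%:R^-1 :> R by lra.
rewrite lnM ?posrE//.
have : ln (1 + n%:R^-1) <= n%:R^-1 :> R by apply: le_ln1Dx; lra.
rewrite -(ler_pM2l n0') mulfV ?gt_eqF// => H; lra.
Qed.

Lemma sum_ln_div_le (R : realType) (N : nat) :
  \sum_(1 <= n < N.+1) ln n.+1%:R / (n.+1%:R * n%:R) <= 2 :> R.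
Proof.
(* The added term dominates the tail of the series, and its decrease from one index to the next pays
   for the new summand. *)
suff H : \sum_(1 <= n < N.+1) ln n.+1%:R / (n.+1%:R * n%:R) + (ln N.+1%:R + 2) / N.+1%:R <= 2 :> R.
  apply: le_trans H; rewrite lerDl divr_ge0 ?ler0n//.
  by have := ln_nat_ge0 R N.+1; lra.
elim: N => [|N IH]; first by rewrite big_geq// add0r ln1 add0r divr1.
apply: le_trans IH; rewrite big_nat_recr//= -addrA lerD2l.
have := ln_natS_le R (ltn0Sn N); have := ln_nat_ge0 R N.+2.
set x : R := N.+1%:R; have x1 : 1 <= x by rewrite ler1n.
have -> : N.+2%:R = x + 1 by rewrite natr1.
move: (ln (x + 1)) (ln x) => b a b0 H.
rewrite -subr_ge0.
have -> : (a + 2) / x - (b / ((x + 1) * x) + (b + 2) / (x + 1)) =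
   ((x + 1) * (a + 2) - b - x * (b + 2)) / ((x + 1) * x).
  by field; rewrite !gt_eqF//; lra.
rewrite divr_ge0//; last by nra.
have : (x + 1) * (b - a) <= 2.
  have [ba|] := leP b a; first by apply: (@le_trans _ _ 0); rewrite ?pmulr_rle0//; lra.
  by move=> ab; have : b - a <= 1 by [nra | nra]; lra.
lra.
Qed.

Lemma sum_inv_pow_le (R : realFieldType) (q : R) (N : nat) : 2 <= q ->
  \sum_(2 <= k < N.+1) (q ^+ k)^-1 <= (q * (q - 1))^-1.
Proof.
move=> q2.
case: N => [|N]; first by rewrite big_geq// invr_ge0; nra.
rewrite big_add1/=.
suff H : \sum_(1 <= k < N.+1) (q ^+ k.+1)^-1 + (q ^+ N.+1 * (q - 1))^-1 <= (q * (q - 1))^-1.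
  apply: le_trans H; rewrite lerDl invr_ge0 mulr_ge0 ?exprn_ge0//; lra.
elim: N => [|N IH]; first by rewrite big_geq// add0r expr1.
apply: le_trans IH; rewrite big_nat_recr//= -addrA lerD2l.
have q0 : 0 < q ^+ N.+1 by rewrite exprn_gt0//; lra.
rewrite [q ^+ N.+2]exprS; move: (q ^+ N.+1) q0 => y y0.
rewrite le_eqVlt; apply/orP; left; apply/eqP.
by field; rewrite !gt_eqF//; lra.
Qed.

Lemma sum_primes_lndiv (R : realType) (N : nat) :
  \sum_(0 <= p < N.+1 | prime p) ln p%:R / (p%:R * (p%:R - 1)) <= 2 :> R.
Proof.
case: N => [|N]; first by rewrite big_mkcond big_nat1/=.
rewrite big_mkcond big_ltn//= add0r big_ltn//= add0r big_add1/=.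
apply: le_trans (sum_ln_div_le R N); rewrite !big_nat; apply: ler_sum => n /andP[n0 _].
have -> : n.+1%:R - 1 = n%:R :> R by rewrite -natr1 addrK.
by case: ifP => // _; rewrite divr_ge0// ln_nat_ge0.
Qed.

(** Proper prime powers matter only up to a constant: the geometric series over [k >= 2] leaves
    [ln p / (p * (p - 1))], whose sum over primes is at most 2. *)
Lemma prime_powers_small (R : realType) (A : nat -> nat -> R) (C : R) (N : nat) :
  0 <= C -> (forall p k, prime p -> `|A p k| <= C / p%:R ^+ k) ->
  `|\sum_(0 <= p < N.+1 | prime p) \sum_(2 <= k < N.+1) ln p%:R * A p k| <= 2 * C.
Proof.
move=> C0 AC.
apply: le_trans (ler_norm_sum _ _ _) _.
apply: (@le_trans _ _ (\sum_(0 <= p < N.+1 | prime p) C * (ln p%:R / (p%:R * (p%:R - 1))))).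
  apply: ler_sum => p pp; rewrite -mulr_sumr normrM ger0_norm ?ln_nat_ge0//.
  rewrite mulrCA; apply: ler_wpM2l; first exact: ln_nat_ge0.
  apply: le_trans (ler_norm_sum _ _ _) _.
  have p2 : 2 <= p%:R :> R by rewrite ler_nat prime_gt1.
  apply: le_trans (ler_wpM2l C0 (sum_inv_pow_le N p2)).
  by rewrite mulr_sumr; apply: ler_sum => k _; exact: AC.
by rewrite -mulr_sumr mulrC; apply: ler_wpM2r => //; exact: sum_primes_lndiv.
Qed.

Lemma char_ln_bounded (R : realType) (chi : nat -> R) (C : R) (N : nat) :
  quadratic_char chi C -> `|\sum_(1 <= n < N.+1) chi n / n%:R * ln n%:R| <= 2 * C.
Proof.
move=> chiC; have [_ _ _ chiS] := chiC.
(* Unlike [ln n / n], the weight [(ln n + 1) / n] decreases from [n = 1] on; the correction is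
   [Lsum]. *)
have -> : \sum_(1 <= n < N.+1) chi n / n%:R * ln n%:R =
    \sum_(1 <= n < N.+1) chi n * ((ln n%:R + 1) / n%:R) - Lsum chi N.
  by rewrite /Lsum -sumrB; apply: eq_bigr => n _; ring.
apply: le_trans (ler_normB _ _) _; rewrite mulr_natl mulr2n; apply: lerD; last exact: Lsum_le.
have := @abel_bound R chi (fun n => (ln n%:R + 1) / n%:R) C 1 N.+1 (chiS 1%N).
rewrite ln1 add0r divr1 mulr1; apply => n n0.
have := ln_nat_ge0 R n; have := ln_nat_ge0 R n.+1; have := ln_natS_le R n0.
have x0 : 0 < n%:R :> R by rewrite ltr0n.
rewrite -natr1; move: (n%:R) x0 => x x0; move: (ln (x + 1)) (ln x) => b a H b0 a0.
have x1 : 0 < x + 1 by lra.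
rewrite divr_ge0 ?(ltW x1)//=; last by lra.
rewrite ler_pdivrMr// mulrAC ler_pdivlMr//; lra.
Qed.

(** [sum_ln_exchange] turns the bounded sum of [chi n * ln n / n] into that of
    [chi p * ln p / p * Lsum chi (N %/ p)], up to proper prime powers. Replacing [Lsum chi (N %/ p)]
    by [Lsum chi N] costs at most [ln p * C / N] per prime, which [theta_le] sums to a constant. It
    remains to divide by [Lsum chi N], which [Lsum_away] permits. *)
Lemma mertens_char (R : realType) (chi : nat -> R) (C : R) : quadratic_char chi C ->
  exists B : R, forall N, `|\sum_(0 <= p < N.+1 | prime p) chi p * (ln p%:R / p%:R)| <= B.
Proof.
move=> chiC; have [delta d0 [N0 dL]] := Lsum_away chiC.
have [chi1 chiM chiE chiS] := chiC.
pose S N := \sum_(0 <= p < N.+1 | prime p) chi p * (ln p%:R / p%:R).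
have C0 := quadratic_charC_ge0 chiC.
have main N : (0 < N)%N -> `|Lsum chi N * S N| <= 2 * C + C * ln 4 + 2 * C.
  move=> N0'; have := sum_ln_exchange (fun n => chi n / n%:R) N.
  set U := LHS; have Ub : `|U| <= 2 * C by exact: char_ln_bounded.
  have AE p k : prime p -> \sum_(1 <= m < (N %/ p ^ k).+1) chi (p ^ k * m)%N / (p ^ k * m)%:R
      = chi (p ^ k)%N / p%:R ^+ k * Lsum chi (N %/ p ^ k).
    move=> pp; rewrite /Lsum mulr_sumr; apply: eq_bigr => m _.
    by rewrite chiM natrM invfM natrX; ring.
  under [RHS]eq_bigr => p pp.
    under eq_bigr => k _ do rewrite (AE p k pp).
    rewrite big_ltn// expn1 expr1; over.
  rewrite big_split/= => UE.
  have small := @prime_powers_small R (fun p k => chi (p ^ k)%N / p%:R ^+ k * Lsum chi (N %/ p ^ k))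
     C N C0.
  have -> : Lsum chi N * S N = U - \sum_(0 <= p < N.+1 | prime p) ln p%:R *
       (chi p / p%:R * (Lsum chi (N %/ p) - Lsum chi N))
      - \sum_(0 <= p < N.+1 | prime p) \sum_(2 <= k < N.+1)
         ln p%:R * (chi (p ^ k)%N / p%:R ^+ k * Lsum chi (N %/ p ^ k)).
    rewrite UE addrAC addrK -sumrB /S mulr_sumr; apply: eq_bigr => p _; ring.
  apply: le_trans (ler_normB _ _) _; apply: lerD; last first.
    apply: small => p k pp; rewrite !normrM normfV.
    rewrite [`|_ ^+ _|]ger0_norm ?exprn_ge0//.
    rewrite -mulrA -[leRHS]mul1r; apply: ler_pM => //.
      exact: quadratic_char_norm chiC.
    rewrite mulrC ler_wpM2r ?invr_ge0 ?exprn_ge0//; exact: Lsum_le.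
  apply: le_trans (ler_normB _ _) _; apply: lerD => //.
  apply: le_trans (ler_norm_sum _ _ _) _.
  apply: (@le_trans _ _ (\sum_(0 <= p < N.+1 | prime p) ln p%:R * (C / N%:R))).
    rewrite big_nat_cond [leRHS]big_nat_cond; apply: ler_sum => p /andP[/andP[_ pN] pp].
    rewrite normrM ger0_norm ?ln_nat_ge0//; apply: ler_wpM2l; first exact: ln_nat_ge0.
    have p0 : 0 < p%:R :> R by rewrite ltr0n prime_gt0.
    have NN : 0 < N%:R :> R by rewrite ltr0n.
    rewrite !normrM normfV (ger0_norm (ltW p0)) distrC.
    have T := Lsum_tail chiC (leq_div N p).
    have F : (N%:R : R) <= p%:R * (N %/ p).+1%:R.
      by rewrite -natrM ler_nat mulnC ltnW// ltn_ceil// prime_gt0.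
    have q0 : 0 < (N %/ p).+1%:R :> R by rewrite ltr0n.
    have X := quadratic_char_norm p chiC.
    apply: (@le_trans _ _ (1 / p%:R * (C / (N %/ p).+1%:R))).
      apply: ler_pM => //.
      by rewrite ler_wpM2r// invr_ge0 ltW.
    rewrite mulf_div mul1r ler_pdivrMr ?mulr_gt0// mulrAC ler_pdivlMr//.
    exact: ler_wpM2l.
  rewrite -mulr_suml mulrC; have T := theta_le R N.
  have NN : 0 < N%:R :> R by rewrite ltr0n.
  apply: le_trans (ler_wpM2l (divr_ge0 C0 (ltW NN)) T) _.
  by rewrite mulrA divfK ?gt_eqF.
(* The first summand serves [N > N0], where [Lsum] is at least [delta]; the second bounds the sum
   trivially for [N <= N0]. *)
exists ((2 * C + C * ln 4 + 2 * C) / delta + \sum_(0 <= p < N0.+2 | prime p) ln p%:R / p%:R).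
have T0 n : 0 <= \sum_(0 <= p < n | prime p) ln p%:R / p%:R :> R.
  by apply: sumr_ge0 => p _; rewrite divr_ge0 ?ln_nat_ge0.
have X0 : 0 <= (2 * C + C * ln 4 + 2 * C) / delta.
  by rewrite divr_ge0 ?(ltW d0)//; have := mulr_ge0 C0 (ln_nat_ge0 R 4); lra.
move=> N; have [NN|NN] := leqP N0.+1 N.
  rewrite -[leLHS]addr0; apply: lerD => //.
  rewrite ler_pdivlMr//; apply: le_trans (main N (leq_trans (ltn0Sn _) NN)).
  by rewrite normrM mulrC ler_wpM2r// dL// ltnW.
rewrite -[leLHS]add0r; apply: lerD => //.
apply: le_trans (ler_norm_sum _ _ _) _.
rewrite [leRHS](big_cat_nat _ (n := N.+1))//=; last exact: ltnW.
rewrite -[leLHS]addr0; apply: lerD; last first.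
  by apply: sumr_ge0 => p _; rewrite divr_ge0 ?ln_nat_ge0.
apply: ler_sum => p _; rewrite normrM [X in _ * X]ger0_norm ?divr_ge0 ?ln_nat_ge0//.
by rewrite ler_piMl ?divr_ge0 ?ln_nat_ge0//; exact: quadratic_char_norm chiC.
Qed.

Lemma ln_fact_ge (R : realType) (N : nat) : (0 < N)%N ->
  N%:R * ln N%:R - N%:R <= \sum_(1 <= n < N.+1) ln n%:R :> R.
Proof.
case: N => // N _; elim: N => [|N IH].
  by rewrite big_nat1 ln1 mulr0 sub0r oppr_le0 ler0n.
rewrite big_nat_recr//=; have := ln_natS_le R (ltn0Sn N).
have -> : N.+2%:R = N.+1%:R + 1 :> R by rewrite natr1.
move: (ln (N.+1%:R + 1)) (ln N.+1%:R) IH => b a IH; move: (N.+1%:R) IH => x; lra.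
Qed.

Lemma ln_fact_primes (R : realType) (N : nat) : (0 < N)%N ->
  \sum_(1 <= n < N.+1) ln n%:R =
  \sum_(0 <= p < N.+1 | prime p) ln p%:R * (N %/ p)%:R +
  \sum_(0 <= p < N.+1 | prime p) \sum_(2 <= k < N.+1) ln p%:R * (N %/ p ^ k)%:R :> R.
Proof.
move=> N0; have := sum_ln_exchange (fun=> 1 : R) N.
under eq_bigr do rewrite mul1r.
move=> ->; rewrite -big_split/=; apply: eq_bigr => p pp.
rewrite big_ltn// expn1; congr (_ * _ + _); first by rewrite sumr_const_nat subn1.
by apply: eq_bigr => k _; rewrite sumr_const_nat subn1.
Qed.

Lemma natr_divn_le (R : realFieldType) (N d : nat) : (0 < d)%N ->
  (N %/ d)%:R <= N%:R / d%:R :> R.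
Proof.
by move=> d0; rewrite ler_pdivlMr ?ltr0n// -natrM ler_nat leq_divM.
Qed.

(** In the constant 3, Stirling's lower bound for [ln N!] accounts for 1 and the proper prime powers
    for 2. *)
Lemma mertens_ge (R : realType) (N : nat) : (0 < N)%N ->
  ln N%:R - 3 <= \sum_(0 <= p < N.+1 | prime p) ln p%:R / p%:R :> R.
Proof.
move=> N0; have := ln_fact_ge R N0; rewrite ln_fact_primes//.
have x0 : 0 < N%:R :> R by rewrite ltr0n.
have := @prime_powers_small R (fun p k => (N %/ p ^ k)%:R) N%:R N (ltW x0).
have D p k : prime p -> `|(N %/ p ^ k)%:R| <= N%:R / p%:R ^+ k :> R.
  move=> pp; rewrite ger0_norm// -natrX natr_divn_le// expn_gt0.
  by rewrite prime_gt0.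
move=> /(_ D) /(le_trans (ler_norm _)).
have : \sum_(0 <= p < N.+1 | prime p) ln p%:R * (N %/ p)%:R <=
   N%:R * \sum_(0 <= p < N.+1 | prime p) ln p%:R / p%:R :> R.
  rewrite mulr_sumr; apply: ler_sum => p pp.
  rewrite mulrCA; apply: ler_wpM2l; first exact: ln_nat_ge0.
  by rewrite natr_divn_le// prime_gt0.
move: (\sum_(_ <= _ < _ | _) _) (\sum_(_ <= _ < _ | _) _) (\sum_(_ <= _ < _ | _) _) => a b c.
move: (ln _) => l H1 H2 H3; rewrite -(ler_pM2l x0); lra.
Qed.

(** Compare with [ln N! <= N * ln N]: replacing [N %/ p] by [N / p] costs at most [ln p] per prime,
    and [N * ln 4] in all by [theta_le]. *)
Lemma mertens_le (R : realType) (N : nat) : (0 < N)%N ->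
  \sum_(0 <= p < N.+1 | prime p) ln p%:R / p%:R <= ln N%:R + ln 4 :> R.
Proof.
move=> N0; have x0 : 0 < N%:R :> R by rewrite ltr0n.
rewrite -(ler_pM2l x0).
apply: (@le_trans _ _ (\sum_(1 <= n < N.+1) ln n%:R + N%:R * ln 4)); last first.
  rewrite mulrDr lerD2r.
  have -> : N%:R * ln N%:R = \sum_(1 <= n < N.+1) ln N%:R :> R.
    by rewrite sumr_const_nat subn1 mulr_natl.
  rewrite !big_nat; apply: ler_sum => n /andP[n0 nN].
  by rewrite ler_ln ?posrE ?ltr0n// ler_nat.
rewrite ln_fact_primes//.
apply: (@le_trans _ _ (\sum_(0 <= p < N.+1 | prime p) ln p%:R * (N %/ p)%:R + N%:R * ln 4)); last first.
  rewrite lerD2r lerDl; apply: sumr_ge0 => p _; apply: sumr_ge0 => k _.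
  by rewrite mulr_ge0// ln_nat_ge0.
apply: (@le_trans _ _ (\sum_(0 <= p < N.+1 | prime p) ln p%:R * (N %/ p)%:R +
   \sum_(0 <= p < N.+1 | prime p) ln p%:R)); last by rewrite lerD2l theta_le.
rewrite mulr_sumr -big_split/=; apply: ler_sum => p pp.
rewrite mulrCA -[X in _ + X]mulr1 -mulrDr; apply: ler_wpM2l; first exact: ln_nat_ge0.
rewrite ler_pdivrMr ?ltr0n ?prime_gt0// natr1 -natrM ler_nat ltnW// ltn_ceil//.
exact: prime_gt0.
Qed.

(** * Real Dirichlet characters modulo 4 and modulo odd primes *)

Definition real_dchar (R : realFieldType) (m : nat) (chi : nat -> R) :=
  [/\ chi 1%N = 1, forall x y, chi (x * y)%N = chi x * chi y,
      forall n, [\/ chi n = 0, chi n = 1 | chi n = -1],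
      forall n, chi (n %% m)%N = chi n & forall n, chi n != 0 -> coprime n m].

Lemma real_dcharM (R : realFieldType) (m1 m2 : nat) (chi1 chi2 : nat -> R) :
  real_dchar m1 chi1 -> real_dchar m2 chi2 ->
  real_dchar (m1 * m2) (fun n => chi1 n * chi2 n).
Proof.
move=> [e1 M1 V1 P1 C1] [e2 M2 V2 P2 C2]; split.
- by rewrite e1 e2 mulr1.
- by move=> x y; rewrite M1 M2 mulrACA.
- move=> n; case: (V1 n) => ->; case: (V2 n) => ->;
    rewrite ?mul0r ?mulr0 ?mulr1 ?mul1r ?mulrNN ?mulr1;
    by [apply: Or31 | apply: Or32 | apply: Or33].
- move=> n; congr (_ * _).
    by rewrite -P1 modn_dvdm ?dvdn_mulr// P1.
  by rewrite -P2 modn_dvdm ?dvdn_mull// P2.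
- move=> n; rewrite mulf_eq0 negb_or => /andP[/C1 n1 /C2 n2].
  by rewrite coprimeMr n1 n2.
Qed.

(** By the Chinese remainder theorem some number is [a] mod [m1] and 1 mod [m2]. *)
Lemma real_dchar_nontriv (R : realFieldType) (m1 m2 : nat) (chi1 chi2 : nat -> R) :
  real_dchar m1 chi1 -> real_dchar m2 chi2 -> coprime m1 m2 ->
  (exists a, chi1 a = -1) -> exists a, chi1 a * chi2 a = -1.
Proof.
move=> [_ _ _ P1 _] [e2 _ _ P2 _] co [a a1].
exists (chinese m1 m2 a 1).
rewrite -P1 -(P2 (chinese _ _ _ _)) chinese_modl// chinese_modr// P1 P2 a1 e2.
by rewrite mulr1.
Qed.

(** Multiplication by an [a] with [chi a = -1] permutes the residues, so the sum equals its own
    negative. *)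
Lemma real_dchar_period (R : realFieldType) (m : nat) (chi : nat -> R) :
  (0 < m)%N -> real_dchar m chi -> (exists a, chi a = -1) ->
  \sum_(0 <= n < m) chi n = 0.
Proof.
case: m => // m _ [e0 M V P C] [a a1].
have co : coprime m.+1 a by rewrite coprime_sym C// a1 oppr_eq0 oner_eq0.
have inj : injective (fun i : 'I_m.+1 => (inord ((a * i) %% m.+1) : 'I_m.+1)).
  move=> i j /(congr1 val)/=; rewrite !inordK ?ltn_mod//.
  wlog ij : i j / (i <= j)%N.
    by move=> H; case: (leqP i j) => [/H//|/ltnW/H{}H e]; apply/esym/H.
  move=> /esym/eqP; rewrite eqn_mod_dvd ?leq_mul2l ?ij ?orbT// -mulnBr Gauss_dvdr//.
  move=> d; apply: val_inj; apply/eqP; rewrite eqn_leq ij/= -subn_eq0.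
  have := ltn_ord j; case: posnP d => // k0 /(dvdn_leq k0); lia.
have : \sum_(i < m.+1) chi i = - \sum_(i < m.+1) chi i.
  rewrite {1}(reindex_inj inj)/= -mulN1r -a1 mulr_sumr; apply: eq_bigr => i _.
  by rewrite inordK ?ltn_mod// P M.
by rewrite big_mkord; lra.
Qed.

Lemma real_dchar_quadratic (R : realFieldType) (m : nat) (chi : nat -> R) :
  (0 < m)%N -> real_dchar m chi -> (exists a, chi a = -1) -> quadratic_char chi m%:R.
Proof.
move=> m0 chiD nt; have [e0 M V P C] := chiD; split => // i j.
have per k : \sum_(k <= n < k + m) chi n = 0.
  elim: k => [|k IH]; first by rewrite add0n (real_dchar_period m0 chiD nt).
  have : \sum_(k <= n < (k + m).+1) chi n = chi (k + m)%N.
    by rewrite big_nat_recr ?leq_addr//= IH add0r.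
  rewrite big_ltn; last by rewrite ltnS leq_addr.
  rewrite -[chi (k + m)%N]P modnDr P addSn => /(congr1 (fun x => x - chi k)).
  by rewrite addrAC subrr add0r.
have [d] := ubnP (j - i); elim: d i j => // d IH i j ijd.
have [ij|ij] := leqP j (i + m).
  apply: le_trans (ler_norm_sum _ _ _) _.
  apply: (@le_trans _ _ (\sum_(i <= n < j) 1)).
    by apply: ler_sum => n _; case: (V n) => ->; rewrite ?normrN ?normr1 ?normr0.
  by rewrite sumr_const_nat ler_nat; lia.
rewrite (big_cat_nat _ (n := i + m))/= ?leq_addr 1?ltnW//.
by rewrite per add0r; apply: IH; lia.
Qed.

Lemma Fp_fermat (p : nat) (u : 'F_p) : prime p -> u != 0 -> u ^+ p.-1 = 1.
Proof.
move=> pp u0; apply: (mulfI u0); rewrite mulr1 -exprS prednK ?prime_gt0//.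
by have := expf_card u; rewrite card_Fp.
Qed.

Lemma card_Fp_nonzero (p : nat) : prime p -> #|[pred x : 'F_p | x != 0]| = p.-1.
Proof.
move=> pp; have := cardC (pred1 (0 : 'F_p)); rewrite card1 card_Fp// => e.
by apply: succn_inj; rewrite prednK ?prime_gt0// -[RHS]e add1n; congr _.+1; exact: eq_card.
Qed.

(* Euler's criterion: [n ^ ((q - 1) / 2)] is the Legendre symbol mod [q]. *)
Definition legendre (R : realFieldType) (q n : nat) : R :=
  let x : 'F_q := n%:R ^+ q.-1./2 in if x == 0 then 0 else if x == 1 then 1 else -1.

Definition chi4 (R : realFieldType) (n : nat) : R :=
  if (n %% 4 == 1)%N then 1 else if (n %% 4 == 3)%N then -1 else 0.

Lemma legendre_dchar (R : realFieldType) (q : nat) : prime q -> odd q ->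
  real_dchar q (legendre R q).
Proof.
move=> qp qo; have ch := pchar_Fp qp.
have q2 : (q.-1./2 * 2 = q.-1)%N.
  have : ~~ odd q.-1 by case: (q) qp qo => // n _ /=; rewrite negbK.
  by move=> /even_halfK; rewrite muln2.
have N11 : (-1 == 1 :> 'F_q) = false.
  apply/negbTE; rewrite -subr_eq0 -opprD oppr_eq0 -(natrD _ 1 1) -(dvdn_pcharf ch).
  by apply: contraTN qo; rewrite dvdn_prime2// => /eqP->.
have N0 : (-1 == 0 :> 'F_q) = false by rewrite oppr_eq0 oner_eq0.
have tri n : [\/ (n%:R ^+ q.-1./2 = 0 :> 'F_q), (n%:R ^+ q.-1./2 = 1 :> 'F_q)
    | (n%:R ^+ q.-1./2 = -1 :> 'F_q)].
  have [->|n0] := eqVneq (n%:R : 'F_q) 0.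
    by rewrite expr0n; case: (_ == _); [apply: Or32|apply: Or31].
  have : ((n%:R : 'F_q) ^+ q.-1./2) ^+ 2 = 1.
    by rewrite -exprM q2 Fp_fermat.
  by move=> /eqP; rewrite sqrf_eq1 => /orP[] /eqP->; [apply: Or32|apply: Or33].
split.
- by rewrite /legendre expr1n oner_eq0 eqxx.
- move=> x y; rewrite /legendre natrM exprMn.
  by case: (tri x) => ->; case: (tri y) => ->;
    rewrite ?mul0r ?mulr0 ?mul1r ?mulr1 ?mulrNN ?mulr1 ?eqxx ?N11 ?N0 ?oner_eq0 ?mulrNN
      ?mulr1 ?mul0r ?mulr0.
- move=> n; rewrite /legendre; case: ifP => _; first exact: Or31.
  by case: ifP => _; [apply: Or32|apply: Or33].
- by move=> n; rewrite /legendre Fp_nat_mod.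
- move=> n; rewrite coprime_sym prime_coprime// (dvdn_pcharf ch); apply: contraNN.
  move=> /eqP n0; rewrite /legendre n0 expr0n; have [e|k0] := eqVneq q.-1./2 0%N; last by rewrite !eqxx.
  by move: q2 qp; rewrite e mul0n; case: (q) => [|[|]].
Qed.

(** The polynomial [X ^ ((q - 1) / 2) - 1] has too few roots to vanish on all [q - 1] nonzero
    residues. *)
Lemma legendre_nontriv (R : realFieldType) (q : nat) : prime q -> odd q ->
  exists a, legendre R q a = -1.
Proof.
move=> qp qo.
have k0 : (0 < q.-1./2)%N by case: (q) qp qo => [|[|[|[]]]].
have [a /andP[a0 a1]] : exists a : 'F_q, (a != 0) && (a ^+ q.-1./2 != 1).
  apply/existsP; rewrite -[X in is_true X]negbK negb_exists; apply/negP => /forallP H.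
  have p0 : 'X^(q.-1./2) - 1%:P != 0 :> {poly 'F_q}.
    by rewrite -size_poly_eq0 size_XnsubC.
  have := max_poly_roots p0 (rs := enum [pred x : 'F_q | x != 0]).
  rewrite enum_uniq => /(_ _ isT); rewrite size_XnsubC// -cardE.
  rewrite card_Fp_nonzero//.
  have K : all (root ('X^(q.-1./2) - 1%:P)) (enum [pred x : 'F_q | x != 0]).
    apply/allP => x; rewrite mem_enum inE => x0; have := H x; rewrite x0/= negbK => /eqP e.
    by rewrite /root !hornerE e subrr.
  by move=> /(_ K); move: k0; lia.
exists (val a); rewrite /legendre natr_Zp (negbTE a1) ifF//.
by apply/negbTE; rewrite expf_neq0.
Qed.

Lemma chi4_dchar (R : realFieldType) : real_dchar 4 (@chi4 R).
Proof.
have lt4 n : (n %% 4 < 4)%N by rewrite ltn_mod.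
split.
- by [].
- move=> x y; rewrite /chi4 -modnMm; move: (x %% 4)%N (y %% 4)%N (lt4 x) (lt4 y).
  by case=> [|[|[|[|]]]]// [|[|[|[|]]]]//= _ _; rewrite ?mul0r ?mulr0 ?mul1r ?mulr1 ?mulrNN ?mulr1.
- move=> n; rewrite /chi4; case: ifP => _; first exact: Or32.
  by case: ifP => _; [apply: Or33|apply: Or31].
- by move=> n; rewrite /chi4 modn_mod.
- move=> n; rewrite /chi4 -coprime_modl; move: (n %% 4)%N (lt4 n).
  by case=> [|[|[|[|]]]]//=; rewrite eqxx.
Qed.

Lemma chi4_nontriv (R : realFieldType) : exists a, chi4 R a = -1.
Proof. by exists 3. Qed.

(** The modulus 4 takes the place of 2, which carries no nontrivial character; distinct good moduli
    are coprime. *)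
Definition good_modulus (m : nat) : bool := (m == 4) || (prime m && odd m).

Definition psi (R : realFieldType) (m : nat) : nat -> R :=
  if m == 4 then @chi4 R else legendre R m.

Definition psis (R : realFieldType) (s : seq nat) (n : nat) : R := \prod_(m <- s) psi R m n.

Lemma psi_dchar (R : realFieldType) (m : nat) : good_modulus m ->
  real_dchar m (psi R m) /\ exists a, psi R m a = -1.
Proof.
rewrite /good_modulus /psi; case: eqP => [-> _|_ /= /andP[pm om]].
  by split; [exact: chi4_dchar | exact: chi4_nontriv].
by split; [exact: legendre_dchar | exact: legendre_nontriv].
Qed.

Lemma good_modulus_gt0 (m : nat) : good_modulus m -> (0 < m)%N.
Proof. by move=> /orP[/eqP->|/andP[/prime_gt0]]. Qed.

Lemma good_modulus_coprime (m1 m2 : nat) : good_modulus m1 -> good_modulus m2 ->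
  m1 != m2 -> coprime m1 m2.
Proof.
rewrite /good_modulus => /orP[/eqP->|/andP[p1 o1]] /orP[/eqP->|/andP[p2 o2]]//.
- by move=> _; rewrite (coprimeXl 2 (m := 2)) ?coprime2n.
- by move=> _; rewrite (coprimeXr 2 (n := 2)) ?coprimen2.
- by rewrite prime_coprime// dvdn_prime2.
Qed.

Lemma psis_dchar (R : realFieldType) (s : seq nat) : all good_modulus s ->
  real_dchar (\prod_(m <- s) m) (psis R s).
Proof.
elim: s => [_|m s IH /= /andP[gm /IH H]].
  rewrite /psis; split => *; rewrite ?big_nil ?mulr1 ?coprimen1//; exact: Or32.
rewrite big_cons /psis; under [X in real_dchar _ X]funext do rewrite big_cons.
by apply: real_dcharM => //; have [] := psi_dchar R gm.
Qed.

Lemma psis_quadratic (R : realFieldType) (s : seq nat) : uniq s -> all good_modulus s ->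
  s != [::] -> exists C, quadratic_char (psis R s) C.
Proof.
case: s => // m s /= /andP[ms us] /andP[gm gs] _.
exists ((\prod_(i <- m :: s) i)%N)%:R.
apply: real_dchar_quadratic.
- rewrite big_seq prodn_cond_gt0// => i; rewrite in_cons => /predU1P[->|/(allP gs)];
    exact: good_modulus_gt0.
- by apply: psis_dchar; rewrite /= gm.
have [dm nt] := psi_dchar R gm.
have [|//|a H] := real_dchar_nontriv dm (psis_dchar R gs).
  rewrite big_seq; elim/big_rec : _ => [|i x si cx]; first exact: coprimen1.
  rewrite coprimeMr cx andbT; apply: good_modulus_coprime => //; first exact: (allP gs).
  by apply: contraNneq ms => ->.
by exists a; rewrite /psis big_cons.
Qed.

(** * Mertens' estimate for primes avoiding the residue 1 *)

(** Expanding the product over [l] one factor at a time gives signed sums of [psis] of longer lists.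
    None of these lists is empty, so each gives a nontrivial character, to which [mertens_char]
    applies. *)
Lemma mertens_product (R : realType) (l a : seq nat) : uniq (a ++ l) ->
  all good_modulus (a ++ l) -> a != [::] ->
  exists B : R, forall N, `|\sum_(0 <= p < N.+1 | prime p)
    psis R a p * \prod_(m <- l) (1 - psi R m p) * (ln p%:R / p%:R)| <= B.
Proof.
elim: l a => [|m l IH] a.
  rewrite cats0 => ua ga a0; have [C /mertens_char[B BP]] := psis_quadratic R ua ga a0.
  exists B => N; rewrite (eq_bigr (fun p => psis R a p * (ln p%:R / p%:R)))// => p _.
  by rewrite big_nil mulr1.
move=> u g a0.
have pe : perm_eq (a ++ m :: l) ((m :: a) ++ l) by rewrite -cat1s perm_catCA.
have sub : subseq (a ++ l) (a ++ m :: l) by rewrite cat_subseq ?subseq_cons.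
have [||//|B1 H1] := IH a; first exact: subseq_uniq u.
  by apply/allP => x /(mem_subseq sub); exact: (allP g).
have [||//|B2 H2] := IH (m :: a).
- by rewrite -(perm_uniq pe).
- by rewrite -(perm_all _ pe).
exists (B1 + B2) => N.
rewrite (eq_bigr (fun p => psis R a p * \prod_(m <- l) (1 - psi R m p) * (ln p%:R / p%:R)
   - psis R (m :: a) p * \prod_(m <- l) (1 - psi R m p) * (ln p%:R / p%:R))); last first.
  by move=> p _; rewrite /psis !big_cons; ring.
by rewrite sumrB; apply: le_trans (ler_normB _ _) _; exact: lerD.
Qed.

(** Only the constant term of the expanded product grows like [ln N]; all other terms are bounded by
    [mertens_product]. *)
Lemma mertens_sieved (R : realType) (l : seq nat) : uniq l -> all good_modulus l ->
  exists B : R, forall N, (0 < N)%N -> ln N%:R - B <= \sum_(0 <= p < N.+1 | prime p)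
    \prod_(m <- l) (1 - psi R m p) * (ln p%:R / p%:R).
Proof.
elim: l => [_ _|m l IH /= /andP[ml ul] /andP[gm gl]].
  exists 3 => N N0; apply: le_trans (mertens_ge R N0) _; apply: ler_sum => p _.
  by rewrite big_nil mul1r.
have [B1 H1] := IH ul gl.
have [//=|//=|//|B2 H2] := @mertens_product R l [:: m]; [by rewrite ml|by rewrite gm|].
exists (B1 + B2) => N N0.
rewrite (eq_bigr (fun p => \prod_(m <- l) (1 - psi R m p) * (ln p%:R / p%:R)
   - psis R [:: m] p * \prod_(m <- l) (1 - psi R m p) * (ln p%:R / p%:R))); last first.
  by move=> p _; rewrite /psis big_seq1 big_cons; ring.
rewrite sumrB opprD addrA; apply: lerB; first exact: H1.
exact: le_trans (ler_norm _) (H2 N).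
Qed.

Definition avoids (l : seq nat) (p : nat) : bool := all (fun m => p != 1 %[mod m]) l.

(** The product in [mertens_sieved] is a sieve weight: it lies between 0 and [2 ^ size l], and
    vanishes when [p] is 1 mod some [m] in [l], as then [psi R m p = 1]. Hence
    [c = 1 / 2 ^ size l]. *)
Lemma mertens_avoids (R : realType) (l : seq nat) : uniq l -> all good_modulus l ->
  exists2 c : R, 0 < c & exists B : R, forall N, (0 < N)%N ->
    c * ln N%:R - B <= \sum_(0 <= p < N.+1 | prime p && avoids l p) ln p%:R / p%:R.
Proof.
move=> ul gl; have [B H] := mertens_sieved R ul gl.
have c0 : 0 < 2 ^+ size l :> R by rewrite exprn_gt0.
exists (2 ^+ size l)^-1; first by rewrite invr_gt0.
exists (B / 2 ^+ size l) => N N0.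
rewrite mulrC -mulrBl ler_pdivrMr//; apply: le_trans (H N N0) _.
rewrite mulrC mulr_sumr big_mkcondr; apply: ler_sum => p _.
have w0 : 0 <= ln p%:R / p%:R :> R by rewrite divr_ge0// ln_nat_ge0.
case: ifPn => [_|].
  rewrite ler_wpM2r//.
  suff [] : 0 <= \prod_(m <- l) (1 - psi R m p) /\
      \prod_(m <- l) (1 - psi R m p) <= 2 ^+ size l by [].
  elim: l gl {ul H c0} => [_|m l IH /= /andP[gm /IH[IH0 IH1]]].
    by rewrite big_nil expr0 ler01.
  have [[_ _ /(_ p) psiE _ _] _] := psi_dchar R gm.
  rewrite big_cons exprS; have [psi0 psi2] : 0 <= 1 - psi R m p /\ 1 - psi R m p <= 2.
    by case: psiE => ->; split; lra.
  by split; [exact: mulr_ge0 | exact: ler_pM].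
rewrite -has_predC => /hasP[m ml /=]; rewrite negbK => /eqP pm.
rewrite (big_rem m)//= [psi R m p](_ : _ = 1) ?subrr ?mul0r//.
have [[e0 _ _ P _] _] := psi_dchar R (allP gl _ ml).
by rewrite -P pm P e0.
Qed.

(** * Integers with an isolated prime factor *)

Definition sum_inv (R : realFieldType) (Q : pred nat) (a b : nat) : R :=
  \sum_(a.+1 <= p < b.+1 | Q p) p%:R^-1.

Lemma sum_inv_cat (R : realFieldType) (Q : pred nat) (a b c : nat) : (a <= b <= c)%N ->
  sum_inv R Q a c = sum_inv R Q a b + sum_inv R Q b c.
Proof. by move=> /andP[ab bc]; rewrite /sum_inv (big_cat_nat _ (n := b.+1)). Qed.

Lemma sum_inv_ge0 (R : realFieldType) (Q : pred nat) (a b : nat) : 0 <= sum_inv R Q a b.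
Proof. by apply: sumr_ge0 => p _; rewrite invr_ge0. Qed.

(* [K] is chosen so large that [c * K * ln u] beats the upper bound [ln u + O(1)] for the
   sum over all primes up to [u]. *)
Lemma avoids_window (R : realType) (l : seq nat) : uniq l -> all good_modulus l ->
  exists K, (0 < K)%N /\ exists u0, forall u, (u0 <= u)%N ->
    K%:R^-1 <= sum_inv R (fun p => prime p && avoids l p) u (u ^ K).
Proof.
move=> ul gl; have [c c0 [B H]] := mertens_avoids R ul gl.
pose K := (Num.bound (3 / c)).+1.
have Kc : 3 <= c * K%:R.
  rewrite mulrC -ler_pdivrMr//.
  have B0 : 0 <= 3 / c by rewrite divr_ge0// ltW.
  by apply: le_trans (ltW (archi_boundP B0)) _; rewrite ler_nat.
(* Once [ln u] exceeds [X], the bound [2 * ln u - B - ln 4] left for the primes of the window is at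
   least [ln u]. *)
pose X := `|B| + ln 4 + 1 : R.
exists K; split=> //; exists (Num.bound (expR X)).+2 => u u0'.
have u2 : (1 < u)%N by exact: leq_trans u0'.
have u0 : (0 < u)%N by exact: leq_trans u0'.
have uX : X <= ln u%:R.
  rewrite -[X]expRK ler_ln ?posrE ?expR_gt0 ?ltr0n//.
  apply: le_trans (ltW (archi_boundP (expR_ge0 X))) _; rewrite ler_nat.
  by apply: leq_trans u0'; exact: leqW.
have uK : (u <= u ^ K)%N by rewrite -{1}(expn1 u) leq_exp2l.
have uK0 : (0 < u ^ K)%N by rewrite expn_gt0 u0.
have := H (u ^ K)%N uK0; rewrite (big_cat_nat _ (n := u.+1))//= natrX lnXn ?ltr0n//.
have S1 : \sum_(0 <= p < u.+1 | prime p && avoids l p) ln p%:R / p%:R <= ln u%:R + ln 4 :> R.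
  apply: le_trans (mertens_le R u0); rewrite big_mkcondr; apply: ler_sum => p _.
  by case: ifP => // _; rewrite divr_ge0// ln_nat_ge0.
have L0 : 0 < ln (u%:R : R) by rewrite ln_gt0// ltr1n.
have S2 : \sum_(u.+1 <= p < (u ^ K).+1 | prime p && avoids l p) ln p%:R / p%:R <=
    K%:R * ln u%:R * sum_inv R (fun p => prime p && avoids l p) u (u ^ K).
  rewrite /sum_inv mulr_sumr big_nat_cond [leRHS]big_nat_cond.
  apply: ler_sum => p /andP[/andP[up pu] /andP[pp _]].
  rewrite ler_wpM2r ?invr_ge0//; apply: (@le_trans _ _ (ln (u ^ K)%N%:R)).
    by rewrite ler_ln ?posrE ?ltr0n ?(prime_gt0 pp)// ler_nat.
  by rewrite natrX lnXn ?ltr0n// mulr_natl.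
rewrite -[_ *+ K]mulr_natl => S3.
have ln40 := ln_nat_ge0 R 4; have nB := ler_norm B.
have K0 : 0 < K%:R :> R by rewrite ltr0n.
rewrite -(ler_pM2l K0) mulfV ?gt_eqF// -(ler_pM2l L0) mulr1.
have : 3 * ln u%:R <= c * (K%:R * ln u%:R) by rewrite mulrA ler_pM2r.
move: S1 S2 S3 uX; rewrite /X.
set s1 := \sum_(0 <= _ < u.+1 | _) _; set s2 := \sum_(u.+1 <= _ < _ | _) _.
move: s1 s2 (sum_inv _ _ _ _) => s1 s2 s3.
move: (ln u%:R) (ln 4) => a b; lra.
Qed.

(** Chain [j] windows, the next one starting at the [K]-th power of the start of the previous
    one. *)
Lemma avoids_windows (R : realType) (l : seq nat) : uniq l -> all good_modulus l ->
  exists K, (0 < K)%N /\ exists u0, forall j u, (u0 <= u)%N ->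
    j%:R / K%:R <= sum_inv R (fun p => prime p && avoids l p) u (u ^ (K ^ j)).
Proof.
move=> ul gl; have [K [K0 [u0 H]]] := avoids_window R ul gl.
exists K; split=> //; exists u0.+1; elim=> [|j IH] u uu.
  by rewrite mul0r sum_inv_ge0.
have v0 : (u <= u ^ (K ^ j))%N.
  by rewrite -{1}(expn1 u) leq_pexp2l ?expn_gt0 ?K0//; exact: leq_trans uu.
have v1 : (u ^ (K ^ j) <= u ^ (K ^ j.+1))%N.
  rewrite expnSr expnM -{1}(expn1 (u ^ _)) leq_pexp2l//.
  by apply: leq_trans v0; exact: leq_trans uu.
rewrite (@sum_inv_cat _ _ _ (u ^ (K ^ j)))%N ?v0// -natr1 mulrDl mul1r.
apply: lerD; first exact: IH.
rewrite expnSr expnM; apply: H; apply: leq_trans v0; exact: ltnW.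
Qed.

Lemma expn_le_exp2 (e l : nat) : ((2 * e) * (2 * e) <= l)%N -> (l.+1 ^ e <= 2 ^ l)%N.
Proof.
case: (posnP e) => [->|e0 el]; first by rewrite expn0 expn_gt0.
pose q := (l %/ (2 * e))%N.
have e20 : (0 < 2 * e)%N by rewrite muln_gt0.
have qe : (2 * e <= q)%N by rewrite leq_divRL.
have lq : (l.+1 <= 2 ^ (2 * q))%N.
  apply: leq_trans (ltn_ceil l e20) _; rewrite [(2 * q)%N]mul2n -addnn expnD.
  apply: leq_mul; first exact: ltn_expl.
  by apply: leq_trans qe _; apply: ltnW; exact: ltn_expl.
apply: (@leq_trans ((2 ^ (2 * q)) ^ e)); first by rewrite leq_exp2r.
rewrite -expnM leq_exp2l// mulnAC mulnC; exact: leq_divM.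
Qed.

(* About [(log N) ^ 2]: it beats the harmonic sum up to [N], and all its fixed powers are
   eventually below [N]. *)
Definition threshold (N : nat) : nat := ((trunc_log 2 N).+1 ^ 2)%N.

(** Choose [j] with [j / K >= E]. As [threshold N] is only polylogarithmic, its fixed power [K ^ j]
    stays below [N] eventually, so that [j] windows fit. *)
Lemma sum_inv_threshold (R : realType) (l : seq nat) (E : R) : uniq l -> all good_modulus l ->
  exists N0, forall N, (N0 <= N)%N ->
    E <= sum_inv R (fun p => prime p && avoids l p) (threshold N) N.
Proof.
move=> ul gl; have [K [K0 [u0 H]]] := avoids_windows R ul gl.
have K0' : 0 < K%:R :> R by rewrite ltr0n.
pose j := Num.bound (`|E| * K%:R).
have jE : E <= j%:R / K%:R.
  rewrite ler_pdivlMr//; apply: le_trans (ltW (archi_boundP _)); last by rewrite mulr_ge0.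
  by rewrite ler_wpM2r ?ler_norm.
pose e := (2 * K ^ j)%N.
exists (2 ^ (u0 + (2 * e) * (2 * e)))%N => N N0.
have := trunc_log_max (ltnSn 1) N0; set L := trunc_log 2 N => LL.
have NL : (2 ^ L <= N)%N.
  by apply: trunc_logP => //; apply: leq_trans N0; rewrite expn_gt0.
have zN : (threshold N ^ (K ^ j) <= N)%N.
  apply: leq_trans NL; rewrite /threshold -expnM; apply: expn_le_exp2; rewrite -/e; lia.
have uz : (u0 <= threshold N)%N.
  rewrite /threshold -/L (@leq_trans L.+1)//; first by lia.
  by rewrite -{1}(expn1 L.+1) leq_pexp2l.
apply: (le_trans jE); apply: (le_trans (H j _ uz)).
rewrite [leRHS](@sum_inv_cat _ _ _ (threshold N ^ (K ^ j)))%N ?lerDl ?sum_inv_ge0//.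
rewrite zN andbT -{1}(expn1 (threshold N)) leq_pexp2l ?expn_gt0 ?K0//.
Qed.

(** * Sieve estimates for divisibility by large primes *)

Lemma count_multiples (R : realFieldType) (d N : nat) : (0 < d)%N ->
  \sum_(1 <= n < N.+1) (d %| n)%N%:R = (N %/ d)%:R :> R.
Proof.
move=> d0; have := sum_multiples (fun=> 1 : R) N d0.
rewrite [RHS]sumr_const_nat subn1/= => <-; rewrite [RHS]big_mkcond.
by apply: eq_bigr => n _; case: (_ %| _)%N.
Qed.

(* The number of [p] in [s] dividing [n] has mean about [E] and variance at most
   about [E] over [n <= N], so it vanishes for at most a proportion [O(1 / E)]. *)
Lemma turan_sieve (R : realFieldType) (s : seq nat) (N : nat) :
  uniq s -> all prime s -> (size s <= N)%N ->
  (\sum_(1 <= n < N.+1) (~~ has (fun p => p %| n)%N s)%:R) * \sum_(p <- s) p%:R^-1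
    <= 3 * N%:R :> R.
Proof.
move=> us ps sN; set M := \sum_(1 <= n < _) _; set E : R := \sum_(p <- s) p%:R^-1.
have EE : E = \sum_(p <- s) p%:R^-1 by [].
clearbody E.
have E0 : 0 <= E by rewrite EE; apply: sumr_ge0 => p _; rewrite invr_ge0.
have [->|En0] := eqVneq E 0; first by rewrite mulr0 mulr_ge0.
have {En0}E0' : 0 < E by rewrite lt_neqAle eq_sym En0.
pose w n : R := \sum_(p <- s) (p %| n)%N%:R.
have p_gt0 p : p \in s -> (0 < p)%N by move=> /(allP ps)/prime_gt0.
(* Rounding down [N / p] loses at most 1 per prime, and there are at most [N] primes in [s]. *)
have W1 : N%:R * E - N%:R <= \sum_(1 <= n < N.+1) w n.
  rewrite exchange_big/= big_seq (eq_bigr (fun p => (N %/ p)%:R)); last first.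
    by move=> p /p_gt0 p0; rewrite count_multiples.
  rewrite -big_seq; apply: (@le_trans _ _ (\sum_(p <- s) (N%:R * p%:R^-1 - 1))).
    rewrite sumrB -mulr_sumr -EE lerD2l lerN2 (_ : \sum_(i <- s) 1 = (size s)%:R :> R).
      by rewrite ler_nat.
    by rewrite big_const_seq count_predT iter_addr addr0.
  rewrite [leLHS]big_seq [leRHS]big_seq; apply: ler_sum => p /p_gt0 p0.
  rewrite lerBlDr ler_pdivrMr ?ltr0n// natr1 -natrM ler_nat ltnW// ltn_ceil//.
(* Distinct primes [p] and [q] both divide at most [N / (p * q)] of the [n]; the diagonal
   contributes the extra [N * E]. *)
have W2 : \sum_(1 <= n < N.+1) w n ^+ 2 <= N%:R * E ^+ 2 + N%:R * E.
  have -> : \sum_(1 <= n < N.+1) w n ^+ 2 = \sum_(p <- s) \sum_(q <- s)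
      \sum_(1 <= n < N.+1) ((p %| n)%N && (q %| n)%N)%:R.
    rewrite [RHS](eq_bigr (fun p => \sum_(1 <= n < N.+1) \sum_(q <- s)
       ((p %| n)%N && (q %| n)%N)%:R)); last by move=> p _; rewrite exchange_big.
    rewrite exchange_big; apply: eq_bigr => n _.
    rewrite expr2 mulr_suml; apply: eq_bigr => p _; rewrite mulr_sumr.
    by apply: eq_bigr => q _; rewrite -mulnb natrM.
  have -> : N%:R * E ^+ 2 + N%:R * E = \sum_(p <- s) \sum_(q <- s)
      (N%:R * p%:R^-1 * q%:R^-1 + (q == p)%:R * (N%:R * p%:R^-1)).
    rewrite expr2 mulrA {2 3}EE !mulr_sumr -big_split/= big_seq [RHS]big_seq.
    apply: eq_bigr => p sp.
    rewrite big_split/= -mulr_suml; congr (_ + _); first by transitivity (N%:R / p%:R * E); [ring | rewrite EE mulr_sumr].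
    rewrite (_ : \sum_(i <- s) (i == p)%:R = 1) ?mul1r//.
    rewrite (bigD1_seq p)//= eqxx big1 ?addr0// => q /negbTE->//.
  rewrite [leLHS]big_seq [leRHS]big_seq; apply: ler_sum => p sp.
  rewrite [leLHS]big_seq [leRHS]big_seq; apply: ler_sum => q sq.
  have p0 := p_gt0 _ sp; have q0 := p_gt0 _ sq.
  have [->|qp] := eqVneq q p.
    rewrite (eq_bigr (fun n => (p %| n)%N%:R)); last by move=> n _; rewrite andbb.
    rewrite count_multiples// mul1r; apply: le_trans (natr_divn_le _ _ p0) _.
    by rewrite lerDr !mulr_ge0// invr_ge0.
  rewrite (eq_bigr (fun n => (p * q %| n)%N%:R)); last first.
    move=> n _; rewrite Gauss_dvd// prime_coprime ?(allP ps)//.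
    by rewrite dvdn_prime2 ?(allP ps)// eq_sym.
  rewrite count_multiples ?muln_gt0 ?p0// mul0r addr0.
  apply: le_trans (natr_divn_le _ _ _) _; first by rewrite muln_gt0 p0.
  by rewrite natrM invfM mulrA.
(* Expanding the square and inserting both moments gives [(N * E ^ 2 + N * E) - 2 * E * (N * E - N)
   + N * E ^ 2]. *)
have V : \sum_(1 <= n < N.+1) (w n - E) ^+ 2 <= 3 * N%:R * E.
  rewrite (eq_bigr (fun n => w n ^+ 2 + (- (2 * E) * w n + E ^+ 2))); last by move=> n _; ring.
  rewrite big_split/= big_split/= -mulr_sumr sumr_const_nat subn1/= -[E ^+ 2 *+ N]mulr_natl.
  have := ler_wpM2l (mulr_ge0 (ler0n R 2) E0) W1; lra.
(* Chebyshev's inequality: [w n = 0] for each [n] counted by [M]. *)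
have ME : M * E ^+ 2 <= \sum_(1 <= n < N.+1) (w n - E) ^+ 2.
  rewrite /M mulr_suml; apply: ler_sum => n _.
  case: (boolP (has _ s)) => [_|/hasPn H]; first by rewrite mul0r sqr_ge0.
  rewrite mul1r /w big_seq big1 ?sub0r ?sqrrN// => p /H/negbTE->//.
have := le_trans ME V; rewrite expr2 mulrA ler_pM2r//.
Qed.

Lemma harmonic_le (R : realFieldType) (N : nat) :
  \sum_(1 <= k < N.+1) k%:R^-1 <= (trunc_log 2 N).+1%:R :> R.
Proof.
have pow l : \sum_(1 <= k < 2 ^ l) k%:R^-1 <= l%:R :> R.
  elim: l => [|l IH]; first by rewrite expn0 big_geq.
  have e : (2 ^ l.+1 = 2 ^ l + 2 ^ l)%N by rewrite expnS mul2n addnn.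
  rewrite (big_cat_nat _ (n := 2 ^ l))//= ?expn_gt0// ?leq_exp2l// -natr1 lerD//.
  rewrite [leRHS](_ : _ = \sum_(2 ^ l <= k < 2 ^ l.+1) ((2 ^ l)%N%:R)^-1); last first.
    rewrite sumr_const_nat e addnK -[RHS]mulr_natl divff//.
  rewrite big_nat [leRHS]big_nat; apply: ler_sum => k /andP[k1 _].
  have k0 : (0 < k)%N by apply: leq_trans k1; rewrite expn_gt0.
  by rewrite lef_pV2 ?posrE ?ltr0n ?expn_gt0// ler_nat.
apply: le_trans (pow _); rewrite [leRHS](big_cat_nat _ (n := N.+1))//=.
  by rewrite lerDl; apply: sumr_ge0 => k _; rewrite invr_ge0.
exact: trunc_log_ltn.
Qed.

Lemma sum_inv_sqr_le (R : realFieldType) (z N : nat) : (0 < z)%N ->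
  \sum_(z.+1 <= p < N.+1) (p%:R ^+ 2)^-1 <= z%:R^-1 :> R.
Proof.
move=> z0; have z0' : 0 < z%:R :> R by rewrite ltr0n.
have [Nz|zN] := leqP N z; first by rewrite big_geq// invr_ge0.
rewrite -(subnKC (ltnW zN)); move: (N - z)%N => m.
suff : \sum_(z.+1 <= p < (z + m).+1) (p%:R ^+ 2)^-1 + (z + m)%:R^-1 <= z%:R^-1 :> R.
  by apply: le_trans; rewrite lerDl invr_ge0.
elim: m => [|m IH]; first by rewrite addn0 big_geq// add0r.
apply: le_trans IH; rewrite addnS big_nat_recr ?ltnS ?leq_addr//= -addrA lerD2l.
have : 0 < (z + m)%:R :> R by rewrite ltr0n addn_gt0 z0.
rewrite -natr1; move: ((z + m)%:R) => x x0.
rewrite -subr_ge0 (_ : _ - _ = (x * (x + 1) ^+ 2)^-1).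
  by rewrite invr_ge0 mulr_ge0 ?ltW// exprn_gt0//; lra.
by field; rewrite !gt_eqF//; lra.
Qed.

Lemma has_le_sum (R : realFieldType) (s : seq nat) (P : pred nat) :
  (has P s)%:R <= \sum_(x <- s) (P x)%:R :> R.
Proof.
elim: s => [|x s IH]; first by rewrite big_nil.
rewrite big_cons /=; case: (P x) => /=; last by rewrite add0r.
by rewrite lerDl sumr_ge0.
Qed.

(** A union bound over all integers [p > z]: at most [N / p ^ 2] of the [n] are divisible by
    [p ^ 2], and at most [N / (k * p ^ 2)] by [p * (k * p + 1)]. The sum over [k] is harmonic, and
    the sum of [1 / p ^ 2] is at most [1 / z]. *)
Lemma entangled_le (R : realFieldType) (z N : nat) : (0 < z)%N ->
  \sum_(1 <= n < N.+1) (has (fun p => (p ^ 2 %| n)%N ||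
       has (fun k => p * (k * p + 1) %| n)%N (index_iota 1 N.+1)) (index_iota z.+1 N.+1))%:R
    <= N%:R * (trunc_log 2 N).+2%:R / z%:R :> R.
Proof.
move=> z0.
apply: (@le_trans _ _ (\sum_(z.+1 <= p < N.+1) \sum_(1 <= n < N.+1)
    ((p ^ 2 %| n)%N%:R + \sum_(1 <= k < N.+1) (p * (k * p + 1) %| n)%N%:R))).
  rewrite exchange_big/=; apply: ler_sum => n _.
  apply: le_trans (has_le_sum _ _ _) _; apply: ler_sum => p _.
  apply: (@le_trans _ _ ((p ^ 2 %| n)%N%:R +
    (has (fun k => p * (k * p + 1) %| n)%N (index_iota 1 N.+1))%:R)).
    by rewrite -natrD ler_nat; case: (_ %| _)%N => //; case: (has _ _).
  by rewrite lerD2l; exact: has_le_sum.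
apply: (@le_trans _ _ (\sum_(z.+1 <= p < N.+1) N%:R * (trunc_log 2 N).+2%:R * (p%:R ^+ 2)^-1)).
  rewrite big_nat [leRHS]big_nat; apply: ler_sum => p /andP[zp _].
  have p0 : (0 < p)%N by exact: leq_trans zp.
  have p0' : 0 < p%:R :> R by rewrite ltr0n.
  have N0 : 0 <= N%:R :> R by rewrite ler0n.
  rewrite big_split/= count_multiples ?expn_gt0 ?p0// exchange_big/=.
  apply: (@le_trans _ _ (N%:R * (p%:R ^+ 2)^-1 + \sum_(1 <= k < N.+1) N%:R * (p%:R ^+ 2)^-1 * k%:R^-1)).
    apply: lerD; first by rewrite -natrX; apply: natr_divn_le; rewrite expn_gt0 p0.
    rewrite big_nat [leRHS]big_nat; apply: ler_sum => k /andP[k0 _].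
    have d0 : (0 < p * (k * p + 1))%N by rewrite muln_gt0 p0 addn1.
    rewrite count_multiples//; apply: le_trans (natr_divn_le _ _ d0) _.
    rewrite -mulrA ler_wpM2l// -invfM -natrX -natrM lef_pV2 ?posrE ?ltr0n ?muln_gt0 ?expn_gt0 ?p0 ?addn1//.
    by rewrite ler_nat; nia.
  rewrite -mulr_sumr -[(trunc_log 2 N).+2%:R]natr1 mulrDr mulr1 mulrDl addrC lerD2r.
  rewrite [leRHS]mulrAC ler_wpM2l ?harmonic_le// mulr_ge0// invr_ge0 exprn_ge0// ltW//.
rewrite -mulr_sumr ler_wpM2l ?mulr_ge0//; exact: sum_inv_sqr_le.
Qed.

(* The last clause says that no divisor of [n] other than [1] is [1] mod [p]. *)
Definition isolated_prime (l : seq nat) (B n p : nat) : Prop :=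
  [/\ prime p /\ (B < p)%N, avoids l p, (p %| n)%N, ~~ (p ^ 2 %| n)%N &
      forall k, (0 < k)%N -> ~~ (k * p + 1 %| n)%N].

(** An exceptional [n] either has no avoiding prime factor above [z], or is counted by
    [entangled_le]. Each case has proportion at most [e / 2]: in the first, reciprocals summing to
    [6 / e] turn the bound [3 * N] of [turan_sieve] into [e / 2 * N]. *)
Lemma isolated_prime_density (R : realType) (l : seq nat) (B : nat) (e : R) :
  uniq l -> all good_modulus l -> 0 < e -> exists N0, forall N, (N0 <= N)%N ->
    (count (fun n => ~~ `[< exists p, isolated_prime l B n p >]) (iota 1 N))%:R <= e * N%:R.
Proof.
move=> ul gl e0; have [N1 H1] := sum_inv_threshold (6 / e) ul gl.
pose b := Num.bound (4 / e).
have be : 4 / e <= b%:R.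
  by apply: ltW; apply: archi_boundP; rewrite divr_ge0// ltW.
exists (N1 + 2 ^ (b + B))%N => N NN.
have {H1} : 6 / e <= sum_inv R (fun p => prime p && avoids l p) (threshold N) N.
  by apply: H1; apply: leq_trans NN; exact: leq_addr.
have : (b + B <= trunc_log 2 N)%N.
  by apply: trunc_log_max => //; apply: leq_trans NN; exact: leq_addl.
rewrite /threshold; set L := trunc_log 2 N; set z := (L.+1 ^ 2)%N => LbB E6.
have z0 : (0 < z)%N by rewrite expn_gt0.
have Lz : (L < z)%N by rewrite /z -{1}(expn1 L.+1) leq_pexp2l.
pose s := [seq p <- index_iota z.+1 N.+1 | prime p && avoids l p].
have T : (\sum_(1 <= n < N.+1) (~~ has (fun p => p %| n)%N s)%:R) * (6 / e) <= 3 * N%:R :> R.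
  apply: le_trans (@turan_sieve R s N _ _ _).
  - apply: ler_wpM2l; first by apply: sumr_ge0.
    by rewrite big_filter.
  - by rewrite filter_uniq// iota_uniq.
  - by apply/allP => p; rewrite mem_filter => /andP[/andP[]].
  - apply: leq_trans (_ : size (index_iota z.+1 N.+1) <= _)%N.
      by rewrite size_filter count_size.
    by rewrite size_iota subSS leq_subr.
have C1 := @entangled_le R z N z0.
(* Since [z = (L + 1) ^ 2], the quotient [(L + 2) / z] is at most [2 / (L + 1)], and
   [L + 1 >= 4 / e]. *)
have C2 : N%:R * L.+2%:R / z%:R <= e / 2 * N%:R.
  have l0 : 0 < L.+1%:R :> R by rewrite ltr0n.
  have eL : 4 <= e * L.+1%:R.
    rewrite mulrC -ler_pdivrMr//; apply: (le_trans be); rewrite ler_nat; lia.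
  have L1 : 1 <= L.+1%:R :> R by rewrite ler1n.
  rewrite ler_pdivrMr ?ltr0n// [leRHS]mulrAC mulrC ler_wpM2r// /z natrX -natr1.
  by move: (L.+1%:R) l0 eL L1 => x l0 eL L1; nra.
have -> : (count (fun n => ~~ `[< exists p, isolated_prime l B n p >]) (iota 1 N))%:R =
    \sum_(1 <= n < N.+1) (~~ `[< exists p, isolated_prime l B n p >])%:R :> R.
  rewrite -sum1_count big_mkcond natr_sum /index_iota subn1/=.
  by apply: eq_bigr => n _; case: (~~ _).
have -> : e * N%:R = e / 2 * N%:R + e / 2 * N%:R by field.
apply: (@le_trans _ _ (\sum_(1 <= n < N.+1) (~~ has (fun p => p %| n)%N s)%:R +
   \sum_(1 <= n < N.+1) (has (fun p => (p ^ 2 %| n)%N ||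
       has (fun k => p * (k * p + 1) %| n)%N (index_iota 1 N.+1)) (index_iota z.+1 N.+1))%:R)); last first.
  apply: lerD; last exact: le_trans C1 C2.
  rewrite -(ler_pM2r (divr_gt0 (ltr0n R 6) e0)); apply: (le_trans T).
  by rewrite le_eqVlt; apply/orP; left; apply/eqP; field; rewrite gt_eqF.
rewrite -big_split/= big_nat [leRHS]big_nat; apply: ler_sum => n /andP[n0 nN].
rewrite -natrD ler_nat; case: (boolP (has _ s)) => [/hasP[p]|_]; last first.
  by rewrite (leq_trans (leq_b1 _))// leq_addr.
rewrite mem_filter mem_index_iota => /andP[/andP[pp av] /andP[zp pN]] pn.
case: (boolP (has _ (index_iota z.+1 N.+1))) => [_|]; first exact: leq_trans (leq_b1 _) _.
move=> /hasPn/(_ p); rewrite mem_index_iota zp pN => /(_ isT); rewrite negb_or => /andP[p2 pk].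
rewrite leqn0 eqb0 negbK; apply/asboolP; exists p; split => //.
  by split=> //; lia.
move=> k k0; apply/negP => kn; move/hasPn: pk => /(_ k).
(* Being coprime to [p], a divisor [k * p + 1] of [n] would make [p * (k * p + 1)] divide [n], with
   [k <= N]. *)
have co : coprime p (k * p + 1) by rewrite /coprime gcdnMDl gcdn1.
rewrite mem_index_iota k0/= Gauss_dvd// pn kn/= => /(_ _)/negP; apply=> //.
have := dvdn_leq n0 kn; have := prime_gt0 pp; nia.
Qed.

(** * Finite quotients *)

(* The Sylow [p]-subgroup [P = <[x]>] is normal with a complement [K]; here [u] acts on [P]
   by [x |-> x ^ (a u)], and [c u] is the exponent of the [P]-part of [u] in [P * K]. *)
Lemma sylow_cocycle (Q : finGroupType) (p : nat) : prime p -> (p %| #|Q|)%N ->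
  ~~ (p ^ 2 %| #|Q|)%N -> (forall k, (0 < k)%N -> ~~ (k * p + 1 %| #|Q|)%N) ->
  exists (a c : Q -> 'F_p) (x : Q),
    [/\ forall u v, a (u * v)%g = a u * a v, forall u, a u ^+ #|Q| = 1,
        forall u v, c (u * v)%g = c u + a u * c v & a x = 1 /\ c x = 1].
Proof.
move=> pp pQ p2Q nk; pose G : {group Q} := [set: Q]%G.
have cG : #|G| = #|Q| by rewrite cardsT.
have Q0 : (0 < #|Q|)%N by rewrite -cG cardG_gt0.
have [P sylP nP] : exists2 P : {group Q}, (p.-Sylow(G) P)%g & fingroup.normal P G.
  apply/normal_sylowP.
  (* The number [m] of Sylow subgroups divides the order and is 1 mod [p]; if [m > 1], it would be a
     forbidden divisor [k * p + 1]. *)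
  have /esym := card_Syl_mod G pp.
  have := card_Syl_dvd p G; rewrite cG; set m := #|_| => mQ m1.
  have e := divn_eq m p; rewrite -m1 in e; apply/eqP.
  case: (posnP (m %/ p)) => [q0|/nk]; first by rewrite e q0 mul0n.
  by rewrite -e mQ.
have cP : #|P| = p.
  rewrite (card_Hall sylP) cG p_part (_ : logn p #|Q| = 1%N) ?expn1//.
  move: pQ p2Q; rewrite -{1}(expn1 p) !pfactor_dvdn// -ltnNge ltnS => h1 h2.
  by apply/eqP; rewrite eqn_leq h1 h2.
have [x Px] : exists x, P :=: <[x]>%g by apply/cyclicP; rewrite prime_cyclic// cP.
have ox : #[x]%g = p by rewrite /order -Px.
have xP : x \in P by rewrite Px cycle_id.
have /splitsP[K /complP[PK1 PKG]] : [splits G, over P]%g.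
  by apply: SchurZassenhaus_split nP; exact: pHall_Hall sylP.
have expE i j : (x ^+ i = x ^+ j)%g -> i%:R = j%:R :> 'F_p.
  move=> /eqP; rewrite eq_expg_mod_order ox => /eqP e.
  by rewrite -(Fp_nat_mod pp) e (Fp_nat_mod pp).
have actE u : exists j, (u * x * u^-1 = x ^+ j)%g.
  have /cycleP[j e] : (x ^ u^-1 \in <[x]>)%g.
    by rewrite -Px memJ_norm// groupV (fintype.subsetP (normal_norm nP))// inE.
  by exists j; rewrite -e conjgE invgK mulgA.
have /boolp.choice[a aE] := actE.
have decE u : exists ik : nat * Q, ik.2 \in K /\ u = (x ^+ ik.1 * ik.2)%g.
  have : (u \in P * K)%g by rewrite PKG inE.
  move=> /mulsgP[y k]; rewrite [in y \in _]Px => /cycleP[i ->] kK ->.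
  by exists (i, k).
have /boolp.choice[d dE] := decE.
have actX u i : (u * x ^+ i * u^-1 = x ^+ (a u * i))%g.
  rewrite expgM -aE; elim: i => [|i IH]; first by rewrite !expg0 mulg1 mulgV.
  by rewrite !expgS -IH !mulgA mulgKV.
have aM u v : (a (u * v)%g)%:R = (a u)%:R * (a v)%:R :> 'F_p.
  rewrite -natrM; apply: expE; rewrite -actX -aE -aE invMg !mulgA.
  by [].
have a1 : (a 1%g)%:R = 1 :> 'F_p.
  by rewrite -[1]/(1%:R); apply: expE; rewrite -aE invg1 mul1g mulg1 expg1.
exists (fun u => (a u)%:R), (fun u => (d u).1%:R), x; split => //.
- move=> u; rewrite -cG.
  have aX n : (a u)%:R ^+ n = (a (u ^+ n)%g)%:R :> 'F_p.
    by elim: n => [|n IH]; rewrite ?expr0 ?expg0 ?a1// exprS IH -aM expgS.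
  by rewrite aX expg_cardG ?inE.
- move=> u v; rewrite -natrM -natrD; apply: expE.
  have [kK uE] := dE u; have [lK vE] := dE v; have [mK wE] := dE (u * v)%g.
  move: (d u).1 (d u).2 (d v).1 (d v).2 (d (u * v)%g).1 (d (u * v)%g).2 kK uE lK vE mK wE.
  move=> i k j l n m kK uE lK vE mK wE.
  (* Since [u = x ^ i * k] and [x ^ i] commutes with powers of [x], [k] acts on [P] as [u] does. *)
  have kx : (k * x ^+ j = x ^+ (a u * j) * k)%g.
    have -> : k = (x ^- i * u)%g by rewrite uE mulKg.
    have ux : (u * x ^+ j = x ^+ (a u * j) * u)%g by rewrite -actX mulgKV.
    rewrite -mulgA ux !mulgA; congr (_ * _)%g.
    exact/commute_sym/commuteV/commuteX2/commute_refl.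
  (* Comparing two decompositions of [u * v], their discrepancy lies in both [P] and [K], hence is
     trivial. *)
  have e : (x ^- (i + a u * j) * x ^+ n = k * l * m^-1)%g.
    have : (x ^+ n * m = x ^+ (i + a u * j) * (k * l))%g.
      by rewrite -wE [in LHS]uE [in LHS]vE expgD !mulgA -(mulgA _ k) kx !mulgA.
    by move=> /(canRL (mulgK _)) ->; rewrite -!mulgA mulKg.
  have : (x ^- (i + a u * j) * x ^+ n)%g \in P :&: K.
    rewrite inE; apply/andP; split; first by rewrite groupM ?groupV ?groupX.
    by rewrite e !groupM ?groupV.
  by rewrite PK1 => /set1P e1; apply: (mulgI (x ^- (i + a u * j))%g); rewrite e1 mulVg.
split.
  rewrite -[1]/(1%:R); apply: expE; rewrite -aE mulgK expg1//.
have [kK xE] := dE x.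
rewrite -[1]/(1%:R); apply: expE; rewrite expg1.
have : (d x).2 \in P :&: K.
  rewrite inE kK andbT (_ : (d x).2 = (x ^- (d x).1 * x)%g); last first.
    by apply: (mulgI (x ^+ (d x).1)%g); rewrite -xE mulKVg.
  by rewrite groupM ?groupV ?groupX.
by rewrite PK1 => /set1P k1; rewrite [RHS]xE k1 mulg1.
Qed.

(** Transporting the group law to ['I_n] makes Sylow theory available for finite quotients of an
    arbitrary group. *)
Lemma finGroup_of_bij (T : groupType) (n : nat) (f : T -> 'I_n) : bijective f ->
  exists (Q : finGroupType) (phi : T -> Q),
    [/\ forall x y, phi (x * y)%g = (phi x * phi y)%g, bijective phi & #|Q| = n].
Proof.
move=> [g fK gK].
pose mul (i j : 'I_n) := f (g i * g j)%g.
pose one : 'I_n := f 1%g.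
pose inv (i : 'I_n) := f (g i)^-1%g.
have mulA : associative mul by move=> i j k; rewrite /mul !fK mulgA.
have mul1 : left_id one mul by move=> i; rewrite /mul fK mul1g gK.
have mulV : left_inverse one inv mul by move=> i; rewrite /mul fK mulVg.
pose Q : finGroupType := HB.pack 'I_n (Finite_isGroup.Build 'I_n mulA mul1 mulV).
exists Q, f; split.
- by move=> x y; rewrite -[RHS]/(mul (f x) (f y)) /mul !fK.
- by exists g.
- exact: card_ord.
Qed.

Lemma chiF_finGroup (G : groupType) (n : nat) : chiF G n ->
  exists (Q : finGroupType) (phi : G -> Q),
    [/\ forall x y, phi (x * y)%g = (phi x * phi y)%g,
        forall q, exists x, phi x = q & #|Q| = n].
Proof.
move=> [N /pcard_eqP/bijPex[f [fI finj fS]]].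
pose f' (q : Defs.quotient N) : 'I_n := Ordinal (fI q I).
have f'bij : bijective f'.
  have /boolp.choice[g gP] : forall i : 'I_n, exists q, f' q = i.
    by move=> i; have [q _ e] := fS i (ltn_ord i); exists q; exact: val_inj.
  exists g => // q; apply: finj; rewrite ?in_setT//.
  exact: (congr1 val (gP (f' q))).
have [Q [phi [phiM [psi phiK psiK] cQ]]] := finGroup_of_bij f'bij.
exists Q, (phi \o quot_pi N); split=> //.
- by move=> x y /=; rewrite -phiM; congr phi; rewrite -quot_mulE.
- by move=> q; have [x e] := quot_piP (psi q); exists x; rewrite /= -e psiK.
Qed.

Lemma chiF_gt0 (G : groupType) (n : nat) : chiF G n -> (0 < n)%N.
Proof.
move=> /chiF_finGroup[Q [phi [_ _ <-]]].
by apply/card_gt0P; exists (phi 1%g).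
Qed.

Lemma chiF_of_fibres (G : groupType) (N : normal_subgroup G) (n : nat) (h : G -> nat) :
  (forall x y, h x = h y <-> normal_set N (x^-1 * y)%g) ->
  (forall k, (k < n)%N <-> exists x, h x = k) -> chiF G n.
Proof.
move=> hN hS; exists N; apply/pcard_eqP/bijPex.
exists (fun q : Defs.quotient N => h (generic_quotient.repr q)); split.
- by move=> q _ /=; apply/hS; exists (generic_quotient.repr q).
- move=> q r _ _ /hN /eq_coset; rewrite /quot_pi !reprK//.
- move=> k /= /hS[x <-]; exists (quot_pi N x) => //.
  by apply/hN; have [_ _ NV] := normal_is_subgroup N;
    have := NV _ (repr_coset N x); rewrite invgM invgK.
Qed.

Lemma has_quotient_surj (G H : groupType) (f : G -> H) :
  (forall x y, f (x * y)%g = (f x * f y)%g) -> (forall y, exists x, f x = y) ->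
  has_quotient G H.
Proof.
move=> fM fS.
have f1 : f 1%g = 1%g by apply: (mulgI (f 1%g)); rewrite -fM !mulg1.
have fV x : f x^-1%g = (f x)^-1%g.
  by apply: (mulgI (f x)); rewrite -fM !mulgV f1.
have kS : is_subgroup [set x | f x = 1%g].
  split=> //= [x y fx fy|x fx]; first by rewrite fM fx fy mulg1.
  by rewrite fV fx invg1.
have kJ x y : [set x | f x = 1%g] x -> [set x | f x = 1%g] (x ^ y)%g.
  by move=> /= fx; rewrite conjgE !fM fx mul1g -fM mulVg.
pose N := NormalSubgroup kS kJ.
have fpi x : f (generic_quotient.repr (quot_pi N x)) = f x.
  have := repr_coset N x; rewrite /= fM fV => e.
  by apply: (mulgI (f x)^-1%g); rewrite e mulVg.
pose phi (q : Defs.quotient N) : H := f (generic_quotient.repr q).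
have phiM : {morph phi : x y / (x * y)%g}.
  move=> a b; have [x ->] := quot_piP a; have [y ->] := quot_piP b.
  by rewrite /phi -[(_ * _)%g]/(quot_mul _ _) quot_mulE !fpi fM.
pose Phi : {multiplicative Defs.quotient N -> H} :=
  HB.pack phi (isMultiplicative.Build _ _ phi phiM).
have /boolp.choice[g gP] := fS.
exists N, Phi, (fun y => quot_pi N (g y)) => [q|y]; last by rewrite /= /phi fpi.
have [x ->] := quot_piP q; apply: eq_coset => /=.
by rewrite /phi fpi fM fV gP mulVg.
Qed.

Lemma has_quotient_hom (G H : groupType) : has_quotient G H ->
  exists f : G -> H, (forall x y, f (x * y)%g = (f x * f y)%g) /\ (forall y, exists x, f x = y).
Proof.
move=> [N [f [g fK gK]]]; exists (fun x => f (quot_pi N x)); split.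
  by move=> x y; rewrite -gmulfM -quot_mulE.
by move=> y; have [x e] := quot_piP (g y); exists x; rewrite -e gK.
Qed.

(** * Twisted homomorphisms of finitely generated groups *)

(** Elimination over the integers: the system, possibly infinite, has a nonzero integer solution, or
    one [D] kills its solutions in every abelian group. If some [w0] has a nonzero first coefficient
    [a], cross-multiplying with it eliminates the first unknown, and [D] picks up the factor [|a|];
    otherwise the first unit vector is a solution. *)
Lemma integer_relations (d : nat) (W : ('I_d -> int) -> Prop) :
  (exists x : 'I_d -> int, (exists i, x i != 0) /\ forall w, W w -> \sum_i w i * x i = 0) \/
  (exists D, (0 < D)%N /\ forall (A : zmodType) (y : 'I_d -> A),
     (forall w, W w -> \sum_i y i *~ w i = 0) -> forall i, y i *+ D = 0).
Proof.
elim: d W => [|d IH] W; first by right; exists 1%N; split=> // A y _ [].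
have [[w0 [Ww0 a0]]|W0] := pselect (exists w, W w /\ w ord0 != 0); last first.
  left; exists (fun i => (i == ord0)%:R); split; first by exists ord0.
  move=> w Ww; rewrite (bigD1 ord0)//= big1 ?addr0 ?mulr1 => [|i /negbTE->]; last by rewrite mulr0.
  by apply: contrapT => /eqP w0; apply: W0; exists w.
set a := w0 ord0 in a0.
pose W' (v : 'I_d -> int) := exists w, W w /\
  forall i, v i = a * w (lift ord0 i) - w ord0 * w0 (lift ord0 i).
have [[x [[i xi] xW]]|[D [D0 DP]]] := IH W'.
  (* Back-substitution: scaling the other unknowns by [a] makes the first one, [- S], an integer. *)
  left; pose S := \sum_i w0 (lift ord0 i) * x i.
  exists (fun i => oapp (fun j => a * x j) (- S) (unlift ord0 i)); split.
    by exists (lift ord0 i); rewrite liftK/= mulf_neq0.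
  move=> w Ww; rewrite big_ord_recl unlift_none/=.
  have := xW (fun i => a * w (lift ord0 i) - w ord0 * w0 (lift ord0 i)).
  rewrite (_ : \sum_i _ = w ord0 * - S + \sum_(j < d) w (lift ord0 j) * (a * x j)).
    under [X in _ -> _ + X = 0]eq_bigr do rewrite liftK/=.
    by apply; exists w.
  rewrite /S mulrN mulr_sumr addrC -sumrB; apply: eq_bigr => j _; ring.
right; exists (`|a| * D)%N; split; first by rewrite muln_gt0 absz_gt0 a0.
move=> A y yW.
have y' j : y (lift ord0 j) *+ D = 0.
  apply: (DP A (fun j => y (lift ord0 j))) => v [w [Ww vE]].
  have := yW _ Ww; have := yW _ Ww0; rewrite !big_ord_recl -/a => e1 e2.
  rewrite (eq_bigr (fun j => y (lift ord0 j) *~ w (lift ord0 j) *~ a -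
      y (lift ord0 j) *~ w0 (lift ord0 j) *~ w ord0)); last first.
    by move=> k _; rewrite vE mulrzBr (mulrC a) (mulrC (w ord0)) !mulrzA.
  rewrite sumrB -!mulrz_suml; move: e1 e2 => /eqP + /eqP.
  rewrite ![y ord0 *~ _ + _]addrC !addr_eq0 => /eqP-> /eqP->.
  by rewrite !mulNrz opprK mulrzAC addNr.
move=> i; case: (unliftP ord0 i) => [j ->|->]; first by rewrite mulnC mulrnA y' mul0rn.
have := yW _ Ww0; rewrite big_ord_recl -/a => /(congr1 (fun z => z *+ D)).
rewrite mul0rn mulrnDl -sumrMnl big1 ?addr0 => [e|j _]; last first.
  by rewrite pmulrn mulrzAC -pmulrn y' mul0rz.
rewrite mulrnA; have [a_ge0|a_lt0] := lerP 0 a.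
  by rewrite [y ord0 *+ _]pmulrn gez0_abs.
by rewrite [y ord0 *+ _]pmulrn ltz0_abs// mulrNz mulNrn e oppr0.
Qed.

(** * Signs and crossed homomorphisms *)

(** Signs are booleans under [(+)], with [true] for -1. *)
Definition flip (V : zmodType) (b : bool) (v : V) : V := if b then - v else v.

Lemma flipD (V : zmodType) (b : bool) (u v : V) : flip b (u + v) = flip b u + flip b v.
Proof. by case: b; rewrite /flip ?opprD. Qed.

Lemma flipN (V : zmodType) (b : bool) (v : V) : flip b (- v) = - flip b v.
Proof. by case: b. Qed.

Lemma flip_flip (V : zmodType) (b c : bool) (v : V) : flip b (flip c v) = flip (b (+) c) v.
Proof. by case: b; case: c; rewrite /flip /= ?opprK. Qed.

Lemma flip_sum (V : zmodType) (b : bool) (d : nat) (F : 'I_d -> V) :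
  flip b (\sum_i F i) = \sum_i flip b (F i).
Proof. by case: b; rewrite /flip ?sumrN. Qed.

Definition sign_hom (G : groupType) (s : G -> bool) : Prop :=
  forall x y, s (x * y)%g = s x (+) s y.

(** A crossed homomorphism to [V], on which [G] acts through [s]; when [s] is a sign homomorphism,
    [(c, s)] is a homomorphism to the semidirect product of [V] with the signs. *)
Definition twisted_hom (G : groupType) (s : G -> bool) (V : zmodType) (c : G -> V) : Prop :=
  forall x y, c (x * y)%g = c x + flip (s x) (c y).

Lemma sign_hom1 (G : groupType) (s : G -> bool) : sign_hom s -> s 1%g = false.
Proof. by move=> /(_ 1%g 1%g); rewrite mulg1; case: (s 1%g). Qed.

Lemma sign_homV (G : groupType) (s : G -> bool) (x : G) : sign_hom s -> s x^-1%g = s x.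
Proof.
move=> sH; have := sH x x^-1%g; rewrite mulgV sign_hom1//.
by case: (s x); case: (s _).
Qed.

Lemma twisted_hom1 (G : groupType) (s : G -> bool) (V : zmodType) (c : G -> V) :
  sign_hom s -> twisted_hom s c -> c 1%g = 0.
Proof.
move=> sH /(_ 1%g 1%g); rewrite mulg1 sign_hom1// /flip => /eqP.
by rewrite -subr_eq0 opprD addNKr oppr_eq0 => /eqP.
Qed.

Lemma twisted_homV (G : groupType) (s : G -> bool) (V : zmodType) (c : G -> V) (x : G) :
  sign_hom s -> twisted_hom s c -> c x^-1%g = - flip (s x) (c x).
Proof.
move=> sH cH; have := cH x^-1%g x; rewrite mulVg (twisted_hom1 sH cH) sign_homV//.
by move/esym/eqP; rewrite addr_eq0 => /eqP.
Qed.

Definition generates (G : groupType) (d : nat) (gen : 'I_d -> G) : Prop :=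
  forall S : set G, is_subgroup S -> (forall i, S (gen i)) -> forall x, S x.

Lemma finitely_generated_gen (G : groupType) : finitely_generated G ->
  exists (d : nat) (gen : 'I_d -> G), generates gen.
Proof.
move=> [A [/finite_seqP[s As] AG]]; exists (size s), (tnth (in_tuple s)) => S SS Sgen x.
have : (smallest (@is_subgroup G) A) x by rewrite AG.
apply; split=> // y; rewrite As /= => /(tnthP (in_tuple s))[i ->]; exact: Sgen.
Qed.

(* The Fox derivatives: [fox gen e g v s] says that some word in the generators with
   value [g] has image [(v, s)] in [Z^d x| {1, -1}], where the [i]-th generator is sent
   to the [i]-th unit vector with sign [e i].  The vectors attached to [g = 1] are the
   equations satisfied by the values of a twisted homomorphism on the generators. *)
Inductive fox (G : groupType) (d : nat) (gen : 'I_d -> G) (e : 'I_d -> bool) :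
    G -> ('I_d -> int) -> bool -> Prop :=
| Fox1 : fox gen e 1%g (fun=> 0) false
| FoxG i : fox gen e (gen i) (fun j => (j == i)%:R) (e i)
| FoxM g v s h w t : fox gen e g v s -> fox gen e h w t ->
    fox gen e (g * h)%g (fun i => v i + flip s (w i)) (s (+) t)
| FoxV g v s : fox gen e g v s -> fox gen e g^-1%g (fun i => - flip s (v i)) s.

Section Fox.
Context (G : groupType) (d : nat) (gen : 'I_d -> G) (e : 'I_d -> bool).

Lemma fox_exists (x : G) : generates gen -> exists v s, fox gen e x v s.
Proof.
move=> genG; apply: (genG [set x | exists v s, fox gen e x v s]) => [|i]; last first.
  by exists (fun j => (j == i)%:R), (e i); exact: FoxG.
split.
- by exists (fun=> 0), false; exact: Fox1.
- by move=> g h [v [s gv]] [w [t hw]]; do 2 eexists; exact: FoxM gv hw.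
- by move=> g [v [s gv]]; do 2 eexists; exact: FoxV gv.
Qed.

Context (s : G -> bool) (sH : sign_hom s) (se : forall i, s (gen i) = e i).

Lemma fox_sign (x : G) v t : fox gen e x v t -> t = s x.
Proof.
elim=> {x v t} [|i|g v t h w u _ -> _ ->|g v t _ ->]; rewrite ?sign_hom1 ?se//.
by rewrite sign_homV.
Qed.

Lemma fox_eval (V : zmodType) (c : G -> V) (x : G) v t : twisted_hom s c ->
  fox gen e x v t -> c x = \sum_i c (gen i) *~ v i.
Proof.
move=> cH; elim=> {x v t} [|i|g v t h w u fg IHg fh IHh|g v t fg IHg].
- by rewrite (twisted_hom1 sH cH) big1// => i _; rewrite mulr0z.
- by rewrite (bigD1 i)//= eqxx big1 ?addr0// => j /negbTE->; rewrite mulr0z.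
- rewrite cH -(fox_sign fg) IHh IHg flip_sum -big_split/=; apply: eq_bigr => i _.
  by rewrite mulrzDr; case: (t); rewrite /flip ?mulrNz.
- rewrite (twisted_homV _ sH cH) -(fox_sign fg) IHg flip_sum -sumrN; apply: eq_bigr => i _.
  by rewrite mulrNz; case: (t); rewrite /flip ?mulrNz.
Qed.

(** Pair the Fox vector of a word for [g] with [x]. The value depends on [g] only: for two words of
    value [g], the first times the inverse of the second has value 1, so its vector pairs to 0. *)
Lemma fox_solution (x : 'I_d -> int) : generates gen ->
  (forall v t, fox gen e 1%g v t -> \sum_i v i * x i = 0) ->
  exists c : G -> int, twisted_hom s c /\ forall i, c (gen i) = x i.
Proof.
move=> genG xW.
have ev g : exists z, exists v t, fox gen e g v t /\ z = \sum_i v i * x i.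
  by have [v [t gv]] := fox_exists g genG; exists (\sum_i v i * x i), v, t.
have /boolp.choice[c cP] := ev.
have cE g v t : fox gen e g v t -> c g = \sum_i v i * x i.
  move=> gv; have [w [u [gw ->]]] := cP g.
  have := xW _ _; have := FoxM gv (FoxV gw); rewrite mulgV => f1 /(_ _ _ f1).
  rewrite (fox_sign gv) (fox_sign gw).
  rewrite (eq_bigr (fun i => v i * x i - w i * x i)) => [|i _].
    by rewrite sumrB => /eqP; rewrite subr_eq0 => /eqP.
  by rewrite flipN flip_flip addbb mulrBl.
exists c; split=> [g h|i].
  have [v [t gv]] := fox_exists g genG; have [w [u hw]] := fox_exists h genG.
  rewrite (cE _ _ _ gv) (cE _ _ _ hw) (cE _ _ _ (FoxM gv hw)) -(fox_sign gv) flip_sum.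
  rewrite -big_split/=; apply: eq_bigr => i _.
  by rewrite mulrDl; case: (t); rewrite /flip ?mulNr.
rewrite (cE _ _ _ (FoxG gen e i)) (bigD1 i)//= eqxx mul1r big1 ?addr0// => j /negbTE->.
by rewrite mul0r.
Qed.

End Fox.

(** * Infinite quotients from integer-valued crossed homomorphisms *)

Lemma int_subgroup_gen (L : int -> Prop) : (forall a b, L a -> L b -> L (a - b)) ->
  (exists a, L a /\ a != 0) -> exists k, (0 < k)%N /\ forall z, L z <-> (k %| z)%Z.
Proof.
move=> LB [a [La a0]].
have L0 : L 0 by rewrite -(subrr a); exact: LB.
have LN b : L b -> L (- b) by move=> Lb; rewrite -sub0r; exact: LB.
have LD b c : L b -> L c -> L (b + c).
  by move=> Lb Lc; rewrite -[c]opprK; apply: LB => //; exact: LN.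
have ex : exists n, (0 < n)%N && `[< L n%:Z >].
  exists `|a|%N; rewrite absz_gt0 a0/=; apply/asboolP.
  by have [h|h] := lerP 0 a; [rewrite gez0_abs | rewrite ltz0_abs//; exact: LN].
case: (ex_minnP ex) => k /andP[k0 /asboolP Lk] kmin.
have Ln n : L (n%:Z * k%:Z).
  by elim: n => [|n IH]; rewrite ?mul0r// intS mulrDl mul1r; exact: LD.
have Lz z : L (z * k%:Z) by case: z => n; rewrite ?NegzE ?mulNr; [|apply: LN]; exact: Ln.
exists k; split=> // z; split=> [Lzz|/dvdzP[q ->]//].
have k0' : k%:Z != 0 by move: k0; rewrite lt0n.
apply/dvdz_mod0P; apply: contrapT => /eqP r0.
have r_ge0 := modz_ge0 z k0'; have rk := ltz_mod z k0'.
have Lr : L (z %% k)%Z.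
  by rewrite /modz; exact: LB.
have := kmin `|(z %% k)%Z|%N; rewrite absz_gt0 r0 gez0_abs// => /(_ (asboolT Lr)).
by move: rk; lia.
Qed.

(** The image is generated by some [k > 0]; dividing by [k] makes the map surjective. *)
Lemma infinite_cyclic_quotient (G : groupType) (c : G -> int) :
  (forall x y, c (x * y)%g = c x + c y) -> (exists x, c x != 0) -> has_quotient G Cinfty.
Proof.
move=> cM [x cx].
have c1 : c 1%g = 0 by have /eqP := cM 1%g 1%g; rewrite mulg1 addrC -subr_eq subrr => /eqP.
have cV y : c y^-1%g = - c y.
  by have /eqP := cM y y^-1%g; rewrite mulgV c1 eq_sym addrC addr_eq0 => /eqP.
have [||k [k0 kP]] := @int_subgroup_gen (fun z => exists y, c y = z).
- by move=> _ _ [y <-] [z <-]; exists (y * z^-1)%g; rewrite cM cV.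
- by exists (c x); split=> //; exists x.
have k0' : k%:Z != 0 by move: k0; rewrite lt0n.
apply: (@has_quotient_surj G Cinfty (fun y => (c y %/ k)%Z)) => [y z|y].
  by rewrite cM divzDl//; apply/kP; exists y.
have /kP[z e] : (k %| (y : int) * k)%Z by exact: dvdz_mull.
by exists z; rewrite e mulzK.
Qed.

(** The element [g] acts as the reflection at 0. Multiplying by [g] changes the sign but not the
    value of [c], so all values of [c] are taken at sign +1, where they form a group generated by
    some [k]; then [(c / k, s)] is surjective. *)
Lemma infinite_dihedral_quotient (G : groupType) (s : G -> bool) (c : G -> int) (g : G) :
  sign_hom s -> twisted_hom s c -> s g -> c g = 0 -> (exists x, c x != 0) ->
  has_quotient G Dinfty.
Proof.
move=> sH cH sg cg [x cx].
have shift y : c (y * g)%g = c y by rewrite cH cg /flip; case: (s y); rewrite ?oppr0 addr0.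
have tr y : exists z, s z = false /\ c z = c y.
  have [sy|sy] := boolP (s y); last by exists y; split=> //; exact/negbTE.
  by exists (y * g)%g; rewrite sH sy sg shift.
have [||k [k0 kP]] := @int_subgroup_gen (fun z => exists y, s y = false /\ c y = z).
- move=> _ _ [y [sy <-]] [z [sz <-]]; exists (y * z^-1)%g.
  by rewrite sH sign_homV// sy sz cH (twisted_homV _ sH cH) sy sz.
- by exists (c x); split=> //; exact: tr.
have k0' : k%:Z != 0 by move: k0; rewrite lt0n.
have kc y : (k %| c y)%Z by apply/kP; exact: tr.
apply: (@has_quotient_surj G Dinfty (fun y => ((c y %/ k)%Z, s y))) => [y z|[m b]].
  rewrite -[RHS]/(dih_mul _ _) /dih_mul/= -sH; congr (_, _).
  by rewrite cH divzDl// /flip /dih_act; case: (s y) => //; have /dvdzP[q ->] := kc z; rewrite -mulNr !mulzK.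
have /kP[z [sz e]] : (k %| m * k)%Z by exact: dvdz_mull.
case: b.
  by exists (z * g)%g; rewrite shift e mulzK// sH sz sg.
by exists z; rewrite e mulzK// sz.
Qed.

Lemma generates_kernel (G : groupType) (d : nat) (gen : 'I_d -> G) (s : G -> bool)
    (V : zmodType) (c : G -> V) (D : nat) : generates gen -> sign_hom s -> twisted_hom s c ->
  (forall i, c (gen i) *+ D = 0) -> forall x, c x *+ D = 0.
Proof.
move=> genG sH cH cD; apply: (genG [set x | c x *+ D = 0]) => //.
have flip0 b (v : V) : v *+ D = 0 -> flip b v *+ D = 0.
  by case: b => //; rewrite /flip mulNrn => ->; rewrite oppr0.
split=> /=.
- by rewrite (twisted_hom1 sH cH) mul0rn.
- by move=> x y cx cy; rewrite cH mulrnDl cx flip0// addr0.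
- by move=> x cx; rewrite (twisted_homV _ sH cH) mulNrn flip0// oppr0.
Qed.

(** Apply [integer_relations] to the Fox vectors of the relations with trivial signs: an integer
    solution would be a nonzero homomorphism to the integers. *)
Lemma no_infinite_cyclic_bound (G : groupType) : finitely_generated G ->
  ~ has_quotient G Cinfty -> exists D, (0 < D)%N /\
    forall (V : zmodType) (c : G -> V), (forall x y, c (x * y)%g = c x + c y) ->
    forall x, c x *+ D = 0.
Proof.
move=> /finitely_generated_gen[d [gen genG]] noZ.
have sH : @sign_hom G (fun=> false) by [].
have [[x [[i xi] xW]]|[D [D0 DP]]] :=
    @integer_relations d (fun v => exists t, fox gen (fun=> false) 1%g v t).
  have [||c [cH cx]] := @fox_solution G d gen (fun=> false) (fun=> false) sH _ x genG => //.
    by move=> v t fv; apply: xW; exists t.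
  case: noZ; apply: (@infinite_cyclic_quotient G c) => [y z|]; first exact: cH.
  by exists (gen i); rewrite cx.
exists D; split=> // V c cM; have cH : twisted_hom (fun=> false) c by move=> x y; exact: cM.
apply: (generates_kernel genG sH cH).
apply: DP => w [t fw]; rewrite -(fox_eval sH _ cH fw)//.
exact: twisted_hom1 sH cH.
Qed.

(** The same dichotomy for each sign pattern [e] on the generators and each generator [i0] of sign
    -1. A principal crossed homomorphism vanishes where the sign is +1, hence the restriction to
    such [x]. *)
Lemma no_infinite_dihedral_bound (G : groupType) : finitely_generated G ->
  ~ has_quotient G Dinfty -> exists D, (0 < D)%N /\
    forall (V : zmodType) (s : G -> bool) (c : G -> V), sign_hom s -> twisted_hom s c ->
    (exists g, s g) -> forall x, s x = false -> c x *+ D = 0.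
Proof.
move=> /finitely_generated_gen[d [gen genG]] noD.
pose ok (ei : {ffun 'I_d -> bool} * 'I_d) (D : nat) := forall (V : zmodType) (s : G -> bool)
  (c : G -> V), sign_hom s -> twisted_hom s c -> (forall i, s (gen i) = ei.1 i) ->
  s (gen ei.2) -> forall x, s x = false -> c x *+ 2 *+ D = 0.
have : forall ei, exists D, (0 < D)%N /\ ok ei D.
  move=> [e i0].
  have [[s0 [sH [se si0]]]|no] := pselect (exists s0 : G -> bool, sign_hom s0 /\
      (forall i, s0 (gen i) = e i) /\ s0 (gen i0)); last first.
    by exists 1%N; split=> // V s c sH cH se si0; case: no; exists s.
  (* The extra relation makes solutions vanish at [gen i0], the reflection that
     [infinite_dihedral_quotient] requires. *)
  have [[x [[j xj] xW]]|[D [D0 DP]]] := @integer_relations d (fun v =>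
      (exists t, fox gen e 1%g v t) \/ v = (fun j => (j == i0)%:R)).
    have [|c [cH cx]] := @fox_solution G d gen e s0 sH se x genG.
      by move=> v t fv; apply: xW; left; exists t.
    case: noD; apply: (@infinite_dihedral_quotient G s0 c (gen i0)) => //; last first.
      by exists (gen j); rewrite cx.
    have := xW _ (or_intror erefl); rewrite (bigD1 i0)//= eqxx mul1r big1 ?addr0 ?cx//.
    by move=> i /negbTE->; rewrite mul0r.
  exists D; split=> // V s c sH' cH se' si x sx.
  (* subtracting a principal crossed homomorphism makes [2 c] vanish at [gen i0] *)
  pose b y := c y *+ 2 - (if s y then c (gen i0) *+ 2 else 0).
  have bH : twisted_hom s b.
    move=> y z; rewrite /b cH mulrnDl flipD flipN.
    have -> : flip (s y) (c z) *+ 2 = flip (s y) (c z *+ 2).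
      by case: (s y); rewrite /flip ?mulNrn.
    rewrite [RHS]addrACA -opprD; congr (_ - _); rewrite sH' /flip.
    by case: (s y); case: (s z); rewrite /= ?subrr ?oppr0 ?addr0 ?add0r.
  have bD : forall y, b y *+ D = 0.
    apply: (generates_kernel genG sH' bH).
    apply: DP => w [[t fw]|->].
      by rewrite -(fox_eval sH' se' bH fw); exact: twisted_hom1 sH' bH.
    rewrite (bigD1 i0)//= eqxx big1 ?addr0 => [|i /negbTE->]; last by rewrite mulr0z.
    by rewrite /b si subrr.
  by have := bD x; rewrite /b sx subr0.
move=> /boolp.choice[D DP].
(* There are finitely many pairs of a sign pattern and a generator, so the product serves them all;
   the factor 2 below undoes the doubling of [c]. *)
pose M := (\prod_ei D ei)%N.
have M0 : (0 < M)%N by rewrite prodn_gt0// => ei; have [] := DP ei.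
exists (2 * M)%N; split; first by rewrite muln_gt0.
move=> V s c sH cH [g sg] x sx.
have [i si] : exists i, s (gen i).
  apply: contrapT => no; suff : s g = false by rewrite sg.
  apply: (genG [set y | s y = false]) => [|i]; last first.
    by apply/negbTE/negP => si; apply: no; exists i.
  split=> /=; first exact: sign_hom1.
  - by move=> y z sy sz; rewrite sH sy sz.
  - by move=> y sy; rewrite sign_homV.
have [_ /(_ V s c sH cH)] := DP ([ffun i => s (gen i)], i).
move=> /(_ (fun i => esym (ffunE _ _)) si x sx) e.
by rewrite mulrnA /M (bigD1 ([ffun i => s (gen i)], i))//= mulrnA e mul0rn.
Qed.

Lemma chiF_infinite_cyclic (G : groupType) : has_quotient G Cinfty ->
  chiF G = [set n : nat | (0 < n)%N].
Proof.
move=> /has_quotient_hom[f [fM' fS]]; apply/seteqP; split=> n /=; first exact: chiF_gt0.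
move=> n0; pose c (x : G) : int := f x.
have cM x y : c (x * y)%g = c x + c y by exact: fM'.
have cH : twisted_hom (fun=> false) c by move=> x y; exact: cM.
have sH : @sign_hom G (fun=> false) by [].
have c1 := twisted_hom1 sH cH; have cV x := twisted_homV x sH cH.
have kS : is_subgroup [set x | (n %| c x)%Z].
  split=> /= [|x y nx ny|x nx]; first by rewrite c1 dvdz0.
    by rewrite cM rpredD.
  by rewrite cV /flip rpredN.
have kJ x y : [set x | (n %| c x)%Z] x -> [set x | (n %| c x)%Z] (x ^ y)%g.
  by move=> /= nx; rewrite conjgE !cM cV /flip addrC addrK.
have n0' : n%:Z != 0 by move: n0; rewrite lt0n.
apply: (@chiF_of_fibres G (NormalSubgroup kS kJ) n (fun x => `|(c x %% n)%Z|%N)) => [x y|k] /=.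
  rewrite cM cV /flip addrC -eqz_mod_dvd; split=> [e|/eqP e]; last by rewrite e.
  by apply/eqP; rewrite -(gez0_abs (modz_ge0 (c x) n0')) -(gez0_abs (modz_ge0 (c y) n0')) e.
split=> [kn|[x <-]]; last first.
  by rewrite -ltz_nat gez0_abs ?modz_ge0// ltz_pmod.
by have [x e] := fS k%:Z; exists x; rewrite /c e modz_small.
Qed.

(** The translations by multiples of [k] have index [2 * k]; a coset of their preimage is determined
    by [c] mod [k] and the sign. *)
Lemma chiF_infinite_dihedral (G : groupType) (k : nat) : has_quotient G Dinfty ->
  (0 < k)%N -> chiF G (2 * k).
Proof.
move=> /has_quotient_hom[f [fM fS]] k0; pose c (x : G) : int := (f x).1.
pose s (x : G) : bool := (f x).2.
have sH : sign_hom s by move=> x y; rewrite /s fM.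
have cH : twisted_hom s c by move=> x y; rewrite /c fM.
have c1 := twisted_hom1 sH cH; have cV x := twisted_homV x sH cH.
have s1 := sign_hom1 sH; have sV x := sign_homV x sH.
have flipP b z : (k %| flip b z)%Z = (k %| z)%Z by case: b; rewrite /flip ?rpredN.
have kS : is_subgroup [set x | s x = false /\ (k %| c x)%Z].
  split=> /= [|x y [sx kx] [sy ky]|x [sx kx]]; first by rewrite s1 c1 dvdz0.
    by rewrite sH sx sy cH sx rpredD.
  by rewrite sV sx cV rpredN flipP.
have kJ x y : [set x | s x = false /\ (k %| c x)%Z] x ->
    [set x | s x = false /\ (k %| c x)%Z] (x ^ y)%g.
  move=> /= [sx kx]; rewrite conjgE !sH sV sx addFb addbb; split=> //.
  rewrite !cH cV sV sx.
  rewrite [X in (_ %| X)%Z](_ : _ = flip (s y) (c x)) ?flipP//.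
  by case: (s y); rewrite /flip /= ?opprK; ring.
have k0' : k%:Z != 0 by move: k0; rewrite lt0n.
have m_ge0 x := modz_ge0 (c x) k0'.
have mlt x : (`|(c x %% k)%Z| < k)%N by rewrite -ltz_nat gez0_abs// ltz_pmod.
apply: (@chiF_of_fibres G (NormalSubgroup kS kJ) (2 * k)
    (fun x => `|(c x %% k)%Z| + s x * k)%N) => [x y|j] /=.
  rewrite sH sV cH sV cV -flipN -flipD flipP addrC -eqz_mod_dvd; split=> [e|[sxy /eqP e]].
    have mx := mlt x; have my := mlt y.
    have sxy : s x = s y by move: e; case: (s x); case: (s y) => //=; lia.
    rewrite sxy addbb; split=> //; apply/eqP.
    by rewrite -(gez0_abs (m_ge0 x)) -(gez0_abs (m_ge0 y)); congr Posz; move: e; rewrite sxy => /addIn.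
  by rewrite e; move: sxy; case: (s x); case: (s y).
split=> [kn|[x <-]]; last first.
  by have := mlt x; case: (s x); lia.
have [jk|kj] := ltnP j k.
  have [x e] := fS (j%:Z, false); exists x.
  by rewrite /c /s e/= modz_small// mul0n addn0.
have [x e] := fS ((j - k)%N%:Z, true); exists x.
rewrite /c /s e/= modz_small ?mul1n; first by rewrite absz_nat subnK.
by rewrite /= ltz_nat; lia.
Qed.

(** * Density of the orders of finite quotients *)

Lemma Fp_primitive_root (p : nat) : prime p -> exists r : 'F_p, p.-1.-primitive_root r.
Proof.
move=> pp; have p1 : (0 < p.-1)%N by case: p pp => [|[]].
have := @has_prim_root 'F_p p.-1 (enum [pred x : 'F_p | x != 0]) p1.
rewrite enum_uniq -cardE card_Fp_nonzero// leqnn => /(_ _ isT isT).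
case/(_ _)/hasP => [|r _ rP]; last by exists r.
apply/allP => u; rewrite mem_enum inE => u0.
by rewrite unity_rootE Fp_fermat.
Qed.

(* Taking discrete logarithms turns [a] into a homomorphism to ['Z_p.-1]. *)
Lemma Fp_char_torsion (G : groupType) (D p : nat) (a : G -> 'F_p) :
  (forall (V : zmodType) (c : G -> V), (forall x y, c (x * y)%g = c x + c y) ->
    forall x, c x *+ D = 0) ->
  prime p -> (forall x y, a (x * y)%g = a x * a y) -> (forall x, a x != 0) ->
  forall x, a x ^+ D = 1.
Proof.
move=> DP pp aM a0 x; have aF y : a y ^+ p.-1 = 1 by exact: Fp_fermat.
(* For [p = 2] the type ['Z_p.-1] does not have [p.-1] elements; there the values of [a], being
   nonzero, are all 1. *)
have [p2|p2] := leqP p.-1 1.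
  have p1 : p.-1 = 1%N by move: p2; case: (p) pp => [|[|[|[]]]].
  by have := aF x; rewrite p1 expr1 => ->; rewrite expr1n.
have [r rP] := Fp_primitive_root pp.
have /boolp.choice[l lE] : forall y, exists i, a y = r ^+ i.
  by move=> y; have [i ->] := prim_rootP rP (aF y); exists i.
have natE i j : i = j %[mod p.-1] -> i%:R = j%:R :> 'Z_(p.-1).
  by move=> e; rewrite -(Zp_nat_mod p2) e Zp_nat_mod.
have lM y z : (l (y * z)%g)%:R = (l y)%:R + (l z)%:R :> 'Z_p.-1.
  rewrite -natrD; apply: natE; apply/eqP.
  by rewrite -(eq_prim_root_expr rP) -lE aM !lE exprD.
have := DP _ (fun y => (l y)%:R : 'Z_p.-1) lM x.
rewrite -mulrnA => /(congr1 (@nat_of_ord _)); rewrite (val_Zp_nat p2) => e.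
rewrite lE -exprM.
have /eqP -> : r ^+ (l x * D) == r ^+ 0 by rewrite (eq_prim_root_expr rP) e ?mod0n.
by rewrite expr0.
Qed.

Definition bad_moduli (D : nat) : seq nat := 4 :: [seq q <- primes D | odd q].

Lemma bad_moduli_uniq (D : nat) : uniq (bad_moduli D).
Proof. by rewrite /= filter_uniq ?primes_uniq// mem_filter. Qed.

Lemma bad_moduli_good (D : nat) : all good_modulus (bad_moduli D).
Proof.
apply/allP => q; rewrite in_cons => /predU1P[->//|].
by rewrite mem_filter mem_primes /good_modulus => /andP[-> /andP[->]]; rewrite orbT.
Qed.

(** An odd prime dividing both [D] and [p - 1] would be a listed modulus with [p] equal to 1. So the
    gcd is a power of 2, and 4 cannot divide it because 4 is listed too. *)
Lemma gcd_avoids (D p : nat) : (0 < D)%N -> prime p -> avoids (bad_moduli D) p ->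
  (gcdn D p.-1 %| 2)%N.
Proof.
move=> D0 pp /allP av; set m := gcdn D p.-1.
have p0 := prime_gt0 pp.
have m0 : (0 < m)%N by rewrite gcdn_gt0 D0.
have eqp q : (q %| p.-1)%N -> p = 1 %[mod q].
  by move=> qp; rewrite -(prednK p0) -addn1 -modnDml (eqP qp).
have : (2.-nat m)%N.
  apply/pnatP => // q qp qm; rewrite inE; apply: contraT => q2.
  have /av : q \in bad_moduli D.
    rewrite in_cons mem_filter mem_primes qp D0 (dvdn_trans qm (dvdn_gcdl _ _)).
    by case/even_prime: qp q2 => [->//|->]; rewrite orbT.
  by move=> /eqP[]; apply: eqp; exact: dvdn_trans qm (dvdn_gcdr _ _).
move=> /p_natP[[|[|k]] e]; rewrite ?e//.
have /av/eqP[] : 4 \in bad_moduli D by rewrite mem_head.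
apply: eqp; apply: dvdn_trans (dvdn_gcdr D _); rewrite -/m e.
by rewrite !expnS mulnA dvdn_mulr.
Qed.

Lemma isolated_prime_dihedral (G : groupType) (D B n p : nat) :
  (0 < D)%N -> (forall (V : zmodType) (c : G -> V),
    (forall x y, c (x * y)%g = c x + c y) -> forall x, c x *+ D = 0) ->
  (D <= B)%N -> (1 < B)%N -> chiF G n -> isolated_prime (bad_moduli D) B n p ->
  ~~ odd n /\ exists (s : G -> bool) (c : G -> 'F_p) (x : G),
    [/\ sign_hom s, twisted_hom s c, exists g, s g, s x = false & c x = 1].
Proof.
move=> D0 DP DB B1 /chiF_finGroup[Q [phi [phiM phiS cQ]]] [[pp pB] av pn p2n kn].
have [|||a [c [x [aM aQ cM [ax cx]]]]] := @sylow_cocycle Q p pp; rewrite ?cQ//.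
have n0 : (0 < n)%N by rewrite -cQ; apply/card_gt0P; exists 1%g.
have a0 u : a u != 0.
  apply/eqP => e; have := aQ u; rewrite e cQ expr0n eqn0Ngt n0 => /eqP.
  by rewrite eq_sym oner_eq0.
have aphiM y z : a (phi (y * z)%g) = a (phi y) * a (phi z) by rewrite phiM aM.
have aD y := Fp_char_torsion DP pp aphiM (fun y => a0 (phi y)) y.
(* The values of [a] have order dividing both [D] and [p - 1], hence dividing 2. *)
have aE u : a u = 1 \/ a u = -1.
  have [y <-] := phiS u; have [k _ /dvdnP[q e]] := Bezoutl p.-1 D0.
  have ag : a (phi y) ^+ gcdn D p.-1 = 1.
    have : a (phi y) ^+ (gcdn D p.-1 + k * p.-1) = 1 by rewrite e mulnC exprM aD expr1n.
    by rewrite exprD mulnC exprM Fp_fermat// expr1n mulr1.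
  have /dvdnP[j e2] := gcd_avoids D0 pp av.
  have : a (phi y) ^+ 2 = 1 by rewrite e2 mulnC exprM ag expr1n.
  by move=> /eqP; rewrite sqrf_eq1 => /orP[] /eqP; [left|right].
have ch := pchar_Fp pp.
have nat0 k : (0 < k < p)%N -> k%:R != 0 :> 'F_p.
  by move=> /andP[k0 kp]; rewrite -(dvdn_pcharf ch) gtnNdvd.
have N11 : (-1 == 1 :> 'F_p) = false.
  apply/negbTE; rewrite -subr_eq0 -opprD oppr_eq0 -(natrD _ 1 1).
  by apply: nat0; exact: leq_trans pB.
pose s y := a (phi y) == -1.
have sE (V : 'F_p) y : a (phi y) * V = flip (s y) V.
  rewrite /s /flip; case: (aE (phi y)) => ->; first by rewrite eq_sym N11 mul1r.
  by rewrite eqxx mulN1r.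
have sH : sign_hom s.
  move=> y z; rewrite /s aphiM.
  by case: (aE (phi y)) => ->; case: (aE (phi z)) => ->;
    rewrite ?mul1r ?mulr1 ?mulrNN ?mulr1 ?eqxx ?[1 == -1]eq_sym ?N11.
have cH : twisted_hom s (fun y => c (phi y)) by move=> y z; rewrite phiM cM sE.
have [y0 y0E] := phiS x.
(* With all signs trivial [c] would be additive, so [D] would kill its value 1, against
   [0 < D < p]. *)
have [g sg] : exists g, s g.
  apply: contrapT => nog; have s0 y : s y = false by apply/negbTE/negP => sy; apply: nog; exists y.
  have cD y z : c (phi (y * z)%g) = c (phi y) + c (phi z) by rewrite cH s0.
  have := DP _ _ cD y0; rewrite y0E cx; apply/eqP/nat0.
  by rewrite D0 (leq_ltn_trans DB).
split.
  apply/negP => on; have := aQ (phi g); rewrite (eqP sg) cQ -signr_odd on expr1 => /eqP.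
  by rewrite N11.
exists s, (fun y => c (phi y)), y0; split=> //; last by rewrite y0E.
- by exists g.
- by rewrite /s y0E ax eq_sym N11.
Qed.

Lemma natural_density_of_bound (R : realType) (X : set nat) (c : R) :
  (forall e : R, 0 < e -> exists N0, forall N, (N0 <= N)%N ->
     `|(count (fun k => k \in X) (iota 1 N))%:R - c * N%:R| <= e * N%:R) ->
  has_natural_density X c.
Proof.
move=> H; apply/cvgrPdist_le => e e0; have [N0 N0P] := H e e0.
exists N0.+1 => // N /= NN; have N1 : 0 < N%:R :> R by rewrite ltr0n (leq_trans _ NN).
rewrite distrC -(ler_pM2r N1); apply: le_trans (N0P N (ltnW NN)).
rewrite -[X in _ * X](gtr0_norm N1) -normrM mulrBl divfK// gt_eqF//.
Qed.

Lemma count_even (N : nat) : count (fun k => ~~ odd k) (iota 1 N) = N./2.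
Proof.
elim: N => // N IH; have -> : iota 1 N.+1 = iota 1 N ++ [:: N.+1].
  by rewrite -(addn1 N) iotaD; congr (_ ++ [:: _]); lia.
by rewrite count_cat IH /= addn0 negbK uphalf_half addnC.
Qed.

(** With a dihedral quotient every positive even order occurs, and an odd order has no isolated
    prime. Without one, an isolated prime [p > D2] would contradict [c x *+ D2 = 0] at [c x = 1], so
    no order has one. *)
Lemma finite_quotient_density (R : realType) (G : groupType) : finitely_generated G ->
  ~ has_quotient G Cinfty ->
  has_quotient G Dinfty /\ has_natural_density (chiF G) (1 / 2 : R) \/
  ~ has_quotient G Dinfty /\ has_natural_density (chiF G) (0 : R).
Proof.
move=> fgG noZ; have [D [D0 DP]] := no_infinite_cyclic_bound fgG noZ.
have dens B e := @isolated_prime_density R (bad_moduli D) B e (bad_moduli_uniq D) (bad_moduli_good D).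
have [hasD|noD] := pselect (has_quotient G Dinfty); [left|right]; split=> //.
- apply: natural_density_of_bound => e e0; have [N0 H] := dens (maxn D 2) (e / 2) (divr_gt0 e0 (ltr0n _ 2)).
  (* The second summand ensures [e * N >= 1], which absorbs the difference between [N / 2] and
     [N./2]. *)
  exists (N0 + Num.bound (1 / e))%N => N NN.
  have Ne : 1 <= e * N%:R.
    rewrite mulrC -ler_pdivrMr//; apply: le_trans (ltW (archi_boundP _)) _.
      by rewrite divr_ge0// ltW.
    by rewrite ler_nat; apply: leq_trans NN; exact: leq_addl.
  have {}H := H N (leq_trans (leq_addr _ _) NN).
  have lo : (N./2 <= count (fun k => k \in chiF G) (iota 1 N))%N.
    rewrite -count_even (@eq_in_count _ _ (fun k => (0 < k)%N && ~~ odd k)); last first.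
      by move=> k; rewrite mem_iota => /andP[->].
    apply: sub_count => k /andP[k0 ek]; apply/mem_set; rewrite -(even_halfK ek) -mul2n.
    by apply: chiF_infinite_dihedral => //; rewrite half_gt0; case: k k0 ek => [|[]].
  have hi : (count (fun k => k \in chiF G) (iota 1 N) <= N./2 + count (fun n =>
      ~~ `[< exists p, isolated_prime (bad_moduli D) (maxn D 2) n p >]) (iota 1 N))%N.
    rewrite -[in leqRHS]count_even -count_predUI; apply: leq_trans (leq_addr _ _).
    apply: sub_count => k /set_mem kG /=; rewrite -implyNb; apply/implyP => ok.
    apply/negP => /asboolP[p iso].
    have [||ek _] := isolated_prime_dihedral D0 DP _ _ kG iso; rewrite ?leq_max ?leqnn ?orbT//.
    by rewrite ek in ok.
  have hN : N%:R = (odd N)%:R + 2 * N./2%:R :> R.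
    by rewrite -natrM -natrD mul2n odd_double_half.
  have odd1 : 0 <= ((odd N)%:R : R) <= 1 by case: (odd N); rewrite ?lexx ?ler01.
  move: lo hi; rewrite -!(ler_nat R) natrD.
  set x : R := (count (in_mem^~ _) _)%:R; set b : R := (count _ _)%:R in H *.
  move: x b (odd N)%:R (N./2%:R) H hN odd1 => x b o h.
  move: (N%:R) Ne => y Ne H hN odd1 lo hi; rewrite ler_norml; lra.
- have [D2 [D20 D2P]] := no_infinite_dihedral_bound fgG noD.
  (* The prime must exceed [D] to exclude trivial signs, 2 to separate 1 from -1, and [D2] to
     contradict the torsion bound. *)
  apply: natural_density_of_bound => e e0; have [N0 H] := dens (maxn (maxn D 2) D2) e e0.
  exists N0 => N NN; rewrite mul0r subr0 ger0_norm//; apply: le_trans (H N NN).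
  rewrite ler_nat; apply: sub_count => k /set_mem kG; apply/negP => /asboolP[p iso].
  have [||_ [s [c [x [sH cH sg sx cx]]]]] := isolated_prime_dihedral D0 DP _ _ kG iso; rewrite ?leq_max ?leqnn ?orbT//.
  have := D2P _ s c sH cH sg x sx; rewrite cx => /eqP.
  have [[pp pB] _ _ _ _] := iso.
  rewrite -(dvdn_pcharf (pchar_Fp pp)) gtnNdvd//; apply: leq_ltn_trans pB; exact: leq_maxr.
Qed.

Theorem theoremA (R : realType) (G : groupType) (fgG : finitely_generated G) :
  exactly_one
    (has_quotient G Cinfty /\ chiF G = [set n : nat | (0 < n)%N])
    ([/\ has_quotient G Dinfty, ~ has_quotient G Cinfty
       & has_natural_density (chiF G) (1 / 2 : R)])
    ([/\ ~ has_quotient G Cinfty, ~ has_quotient G Dinfty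
       & has_natural_density (chiF G) (0 : R)]).
Proof.
split; last by split=> [[[? ?] [_ ? _]]|[[? ?] [? _ _]]|[[? _ _] [_ ? _]]].
have [hasZ|noZ] := pselect (has_quotient G Cinfty).
  by left; split=> //; exact: chiF_infinite_cyclic.
by right; have [[hasD d]|[noD d]] := finite_quotient_density R fgG noZ; [left|right].
Qed.
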